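(* Let $G\le \mathrm{Homeo}_+(\mathbb{S}^1)$ be an elementary, Möbius-like subgroup. Then $G$ is continuously semi-conjugate to an elementary subgroup of $\mathrm{PSL}(2,\mathbb{R})$ and, moreover, the corresponding morphism $G\to \mathrm{PSL}(2,\mathbb{R})$ is injective. That is, there exists an injective homomorphism $\psi:G\to \mathrm{PSL}(2,\mathbb{R})$, whose image is an elementary subgroup of $\mathrm{PSL}(2,\mathbb{R})$, such that the inclusion $\varphi:G\hookrightarrow \mathrm{Homeo}_+(\mathbb{S}^1)$ is continuously semi-conjugate to $\psi:G\to\mathrm{PSL}(2,\mathbb{R})\subset \mathrm{Homeo}_+(\mathbb{S}^1)$.
   Context: $\mathbb{S}^1=\mathbb{R}/\mathbb{Z}$, and $\mathrm{Homeo}_+(\mathbb{S}^1)$ is the group of orientation-preserving homeomorphisms of the circle. $\mathrm{PSL}(2,\mathbb{R})$ is regarded as a subgroup of $\mathrm{Homeo}_+(\mathbb{S}^1)$ through its action by projective transformations on $\mathbb{RP}^1\cong\mathbb{S}^1$ (equivalently, its action on the circle at infinity of the hyperbolic disc). A subgroup of $\mathrm{Homeo}_+(\mathbb{S}^1)$ is elementary if it preserves a Borel probability measure on $\mathbb{S}^1$. (For subgroups of $\mathrm{PSL}(2,\mathbb{R})$ this agrees with the usual notion: the action on the closed disc $\overline{\mathbb{D}}$ has a finite orbit.) A subgroup $G\le\mathrm{Homeo}_+(\mathbb{S}^1)$ is Möbius-like if every element of $G$ is individually conjugate (in $\mathrm{Homeo}_+(\mathbb{S}^1)$) to an element of $\mathrm{PSL}(2,\mathbb{R})$.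 Continuous semi-conjugacy: let $\mathrm{Homeo}_{\mathbb{Z}}(\mathbb{R})$ be the group of homeomorphisms of $\mathbb{R}$ commuting with integer translations, so that $1\to\mathbb{Z}\to\mathrm{Homeo}_{\mathbb{Z}}(\mathbb{R})\to\mathrm{Homeo}_+(\mathbb{S}^1)\to 1$ is a central extension. Given homomorphisms $\varphi,\psi:G\to\mathrm{Homeo}_+(\mathbb{S}^1)$, one says that $\varphi$ is continuously semi-conjugate to $\psi$ if there exist a cyclic central extension $1\to\mathbb{Z}\to\widetilde G\to G\to1$, homomorphisms $\widetilde\varphi,\widetilde\psi:\widetilde G\to\mathrm{Homeo}_{\mathbb{Z}}(\mathbb{R})$ which lift $\varphi$ and $\psi$ respectively and send every integer $n\in\mathbb{Z}\subset\widetilde G$ to the translation by $n$, and a continuous non-decreasing map $h:\mathbb{R}\to\mathbb{R}$ with $|h(x)|\to\infty$ as $|x|\to\infty$ such that $h(\widetilde\varphi(g)(x))=\widetilde\psi(g)(h(x))$ for all $g\in\widetilde G$ and $x\in\mathbb{R}$. *)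

(* Defs.v *)
From HB Require Import structures.
From mathcomp Require Import all_boot all_order all_algebra.
From mathcomp Require Import archimedean generic_quotient ring_quotient.
From mathcomp Require Import all_classical all_reals all_analysis.

Set Implicit Arguments.
Unset Strict Implicit.
Unset Printing Implicit Defensive.

Import Order.TTheory GRing.Theory Num.Theory.
Import numFieldNormedType.Exports.

Local Open Scope classical_set_scope.
Local Open Scope ring_scope.

Section Subgroups.
Variables (H : groupType) (G : groupClosed H).

Definition subgroup := {x : H | x \in G}.

HB.instance Definition _ := SubChoice.on subgroup.

Fact subgroup_closed : group_closed [pred x | x \in G].
Proof. by split=> [|x y xG yG]; [exact: gpred1 | exact: gpredF]. Qed.

HB.instance Definition _ :=
  SubChoice_isSubGroup.Build H [pred x | x \in G] subgroup subgroup_closed.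

End Subgroups.

(* The product of [homeo T] is composition: (f * g) x = f (g x). *)
Section Homeomorphisms.
Variable T : topologicalType.

Definition is_homeo : pred (T -> T) := fun f =>
  `[< continuous f /\
      exists g : T -> T, [/\ continuous g, cancel f g & cancel g f] >].

Record homeo := Homeo { homeo_fun :> T -> T; _ : is_homeo homeo_fun }.

HB.instance Definition _ := [isSub for homeo_fun].
HB.instance Definition _ := [Choice of homeo by <:].

Lemma homeo_continuous (f : homeo) : continuous f.
Proof. by case: f => f /= /asboolP[]. Qed.

Lemma homeo_inv_exists (f : homeo) :
  exists g : T -> T, [/\ continuous g, cancel f g & cancel g f].
Proof. by case: f => f /= /asboolP[]. Qed.

Definition homeo_inv_fun (f : homeo) : T -> T := sval (cid (homeo_inv_exists f)).

Lemma homeo_inv_funK (f : homeo) : cancel f (homeo_inv_fun f).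
Proof. by rewrite /homeo_inv_fun; case: cid => g []. Qed.

Lemma homeo_inv_funVK (f : homeo) : cancel (homeo_inv_fun f) f.
Proof. by rewrite /homeo_inv_fun; case: cid => g []. Qed.

Lemma homeo_inv_continuous (f : homeo) : continuous (homeo_inv_fun f).
Proof. by rewrite /homeo_inv_fun; case: cid => g []. Qed.

Fact homeo_one_subproof : is_homeo id.
Proof. by apply/asboolP; split=> [x|]; [|exists id; split=> // x]; exact: cvg_id. Qed.

Fact homeo_mul_subproof (f g : homeo) : is_homeo (f \o g).
Proof.
apply/asboolP; split.
  by move=> x; apply: continuous_comp; exact: homeo_continuous.
exists (homeo_inv_fun g \o homeo_inv_fun f); split.
- by move=> x; apply: continuous_comp; exact: homeo_inv_continuous.
- by apply: can_comp; exact: homeo_inv_funK.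
- by apply: can_comp; exact: homeo_inv_funVK.
Qed.

Fact homeo_inv_subproof (f : homeo) : is_homeo (homeo_inv_fun f).
Proof.
apply/asboolP; split; first exact: homeo_inv_continuous.
exists f; split; [exact: homeo_continuous | exact: homeo_inv_funVK |].
exact: homeo_inv_funK.
Qed.

Definition homeo_one := Homeo homeo_one_subproof.
Definition homeo_mul f g := Homeo (homeo_mul_subproof f g).
Definition homeo_inv f := Homeo (homeo_inv_subproof f).

Fact homeo_mulA : associative homeo_mul.
Proof. by move=> f g k; exact: val_inj. Qed.
Fact homeo_1mul : left_id homeo_one homeo_mul.
Proof. by move=> f; exact: val_inj. Qed.
Fact homeo_mul1 : right_id homeo_one homeo_mul.
Proof. by move=> f; exact: val_inj. Qed.
Fact homeo_Vmul : left_inverse homeo_one homeo_inv homeo_mul.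
Proof. by move=> f; apply/val_inj/funext => x; exact: homeo_inv_funK. Qed.
Fact homeo_mulV : right_inverse homeo_one homeo_inv homeo_mul.
Proof. by move=> f; apply/val_inj/funext => x; exact: homeo_inv_funVK. Qed.

HB.instance Definition _ := isGroup.Build homeo
  homeo_mulA homeo_1mul homeo_mul1 homeo_Vmul homeo_mulV.

Lemma homeo1E (x : T) : (1%g : homeo) x = x. Proof. by []. Qed.
Lemma homeoME (f g : homeo) (x : T) : (f * g)%g x = f (g x). Proof. by []. Qed.
Lemma homeoK (f : homeo) : cancel f (f^-1)%g.
Proof. exact: homeo_inv_funK. Qed.
Lemma homeoVK (f : homeo) : cancel (f^-1)%g f.
Proof. exact: homeo_inv_funVK. Qed.

End Homeomorphisms.

Section Circle.
Variable R : realType.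

Definition Z_in_R : zmodClosed R :=
  GRing.ZmodClosed.clone R (@Num.int_num_subdef R) _.

Definition circle : Type := quotient_topology (Quotient.quot Z_in_R).

HB.instance Definition _ := PointedTopological.on circle.

Definition to_circle (x : R) : circle := (\pi_circle x)%qT.

Lemma to_circle_eq (x y : R) :
  to_circle x = to_circle y <-> x - y \is a Num.int.
Proof.
rewrite (_ : (x - y \is a Num.int) = (x == y %[mod Quotient.quot Z_in_R])%qT).
  by split=> [e|/eqP e]; [apply/eqP|]; exact: e.
exact: Quotient.idealrBE.
Qed.

Definition lifts (F : R -> R) (f : circle -> circle) :=
  forall x, f (to_circle x) = to_circle (F x).

(* A homeomorphism of R / Z preserves the orientation when it lifts to an
   increasing homeomorphism of the universal cover R. *)
Definition orientation_preserving : {pred homeo circle} := fun f =>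
  `[< exists F : homeo R, {homo F : x y / x < y} /\ lifts F f >].

Fact orientation_preserving_closed : group_closed orientation_preserving.
Proof.
split=> [|f g /asboolP[F [Finc Ff]] /asboolP[K [Kinc Kg]]]; apply/asboolP.
  by exists 1%g; split=> // x.
have Kmono : {mono K : x y / x <= y} by exact: le_mono.
exists (F * K^-1)%g; split=> x => [y xy|].
  by rewrite !homeoME; apply: Finc; rewrite -(leW_mono Kmono) !homeoVK.
by rewrite !homeoME -Ff -[in LHS](homeoVK K x) -Kg homeoK.
Qed.

HB.instance Definition _ := isMulClosed.Build (homeo circle)
  orientation_preserving (group_closedM orientation_preserving_closed).
HB.instance Definition _ := isMul1Closed.Build (homeo circle)
  orientation_preserving orientation_preserving_closed.1.
HB.instance Definition _ := isInvClosed.Build (homeo circle)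
  orientation_preserving (group_closedV orientation_preserving_closed).

Definition homeo_plus : Type := subgroup orientation_preserving.
HB.instance Definition _ := SubGroup.on homeo_plus.

Definition homeo_plus_fun (f : homeo_plus) : circle -> circle := homeo_fun (val f).
Coercion homeo_plus_fun : homeo_plus >-> Funclass.

Definition Z_equivariant : {pred homeo R} := fun F =>
  `[< forall (x : R) (n : int), F (x + n%:~R) = F x + n%:~R >].

Fact Z_equivariant_closed : group_closed Z_equivariant.
Proof.
split=> [|F K /asboolP FZ /asboolP KZ]; apply/asboolP => // x n.
rewrite !homeoME -FZ; congr (F _).
by apply: (can_inj (homeoK K)); rewrite KZ !homeoVK.
Qed.

HB.instance Definition _ := isMulClosed.Build (homeo R)
  Z_equivariant (group_closedM Z_equivariant_closed).
HB.instance Definition _ := isMul1Closed.Build (homeo R)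
  Z_equivariant Z_equivariant_closed.1.
HB.instance Definition _ := isInvClosed.Build (homeo R)
  Z_equivariant (group_closedV Z_equivariant_closed).

Definition homeo_Z : Type := subgroup Z_equivariant.
HB.instance Definition _ := SubGroup.on homeo_Z.

Definition homeo_Z_fun (F : homeo_Z) : R -> R := homeo_fun (val F).
Coercion homeo_Z_fun : homeo_Z >-> Funclass.

(* The identification of R / Z with the real projective line: the class of x is
   sent to the line spanned by (cos (pi x), sin (pi x)). *)
Definition direction (x : R) : 'cV[R]_2 :=
  \col_i (if i == 0 then cos (pi * x) else sin (pi * x)).

Definition proj_line (p : circle) : set 'cV[R]_2 :=
  [set v | exists x (c : R), to_circle x = p /\ v = c *: direction x].

(* PSL(2, R) as the group of the circle homeomorphisms induced by matrices of
   determinant 1; opposite matrices induce the same homeomorphism. *)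
Definition is_projective : {pred homeo_plus} := fun f =>
  `[< exists A : 'M[R]_2, \det A = 1 /\
      forall p, proj_line (f p) = [set A *m v | v in proj_line p] >].

Fact is_projective1 : (1%g : homeo_plus) \in is_projective.
Proof.
apply/asboolP; exists 1%:M; split=> [|p]; first exact: det1.
by apply/seteqP; split=> [v pv|_ [v pv <-]]; [exists v|]; rewrite ?mul1mx.
Qed.

Fact is_projectiveF (f g : homeo_plus) :
  f \in is_projective -> g \in is_projective -> (f / g)%g \in is_projective.
Proof.
move=> /asboolP[A [detA fA]] /asboolP[B [detB gB]]; apply/asboolP.
have uB : B \in unitmx by rewrite unitmxE detB unitr1.
pose gV : homeo_plus := (g^-1)%g.
exists (A *m invmx B); split=> [|p].
  by rewrite det_mulmx det_inv detA detB invr1 mulr1.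
have gVK : g (gV p) = p by exact: (homeoVK (val g)).
rewrite -[homeo_plus_fun _ p]/(f (gV p)) fA -[in RHS]gVK gB.
apply/seteqP; split=> [_ [v pv <-]|_ [_ [v pv <-] <-]].
  by exists (B *m v); [exists v | rewrite -mulmxA mulKmx].
by exists v; rewrite // -mulmxA mulKmx.
Qed.

Fact is_projective_closed : group_closed is_projective.
Proof. by split; [exact: is_projective1 | exact: is_projectiveF]. Qed.

HB.instance Definition _ := isMulClosed.Build homeo_plus
  is_projective (group_closedM is_projective_closed).
HB.instance Definition _ := isMul1Closed.Build homeo_plus
  is_projective is_projective_closed.1.
HB.instance Definition _ := isInvClosed.Build homeo_plus
  is_projective (group_closedV is_projective_closed).

Definition PSL2 : Type := subgroup is_projective.
HB.instance Definition _ := SubGroup.on PSL2.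

Definition borel_circle := g_sigma_algebraType (@open circle).

Definition elementary (S : set homeo_plus) :=
  exists mu : probability borel_circle R, forall f, S f ->
    forall A : set borel_circle, measurable A -> mu (f @^-1` A) = mu A.

Definition mobius_like (S : set homeo_plus) :=
  forall g, S g -> exists k : homeo_plus, (g ^ k)%g \in is_projective.

(* 1 -> Z -> Gt -> G -> 1, with Z written additively. *)
Definition central_extension_by_Z (G Gt : groupType)
    (iota : int -> Gt) (p : Gt -> G) :=
  [/\ forall m n, iota (m + n) = (iota m * iota n)%g,
      injective iota,
      range iota = [set g | p g = 1%g],
      range p = setT
    & forall n g, commute (iota n) g].

Definition continuously_semiconjugate (G : groupType)
    (phi psi : G -> homeo_plus) :=
  exists (Gt : groupType) (iota : int -> Gt) (p : {multiplicative Gt -> G})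
    (phit psit : {multiplicative Gt -> homeo_Z}) (h : R -> R),
  [/\ central_extension_by_Z iota p,
      forall g, lifts (homeo_Z_fun (phit g)) (phi (p g)) /\
                lifts (homeo_Z_fun (psit g)) (psi (p g)),
      forall n x, homeo_Z_fun (phit (iota n)) x = x + n%:~R /\
                  homeo_Z_fun (psit (iota n)) x = x + n%:~R,
      [/\ continuous h,
          {homo h : x y / x <= y},
          `|h x| @[x --> +oo] --> +oo
        & `|h x| @[x --> -oo] --> +oo]
    & forall g x, h (homeo_Z_fun (phit g) x) = homeo_Z_fun (psit g) (h x)].

End Circle.

(* Main.v *)
Require Import Defs.
From HB Require Import structures.
From mathcomp Require Import all_boot all_order all_algebra.
From mathcomp Require Import archimedean generic_quotient lra zify ring.
From mathcomp Require Import all_classical all_reals all_analysis.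

Set Implicit Arguments.
Unset Strict Implicit.
Unset Printing Implicit Defensive.

Import Order.TTheory GRing.Theory Num.Theory.
Import numFieldNormedType.Exports.

Local Open Scope classical_set_scope.
Local Open Scope ring_scope.

(** Let Gt be the group of the increasing lifts to R of the elements of G; the integer
    translations make it a central extension of G by Z.  The whole conclusion follows from one
    nondecreasing surjection h : R -> R of degree one such that each F in Gt is carried by h to a
    lift P of a projective map, h o F = P o h ([semiconjugacy_of_map]).  Since h is onto, P is
    determined by F, so that the P form a group morphism which descends to psi; the image under
    h of an invariant measure is invariant under psi; and psi is injective because no F but the
    identity satisfies h o F = h ([invariant_map_trivial]).

    The hypothesis that G is Moebius-like is used through a single fact: an F in Gt other than
    the identity has at most two fixed points modulo 1 and, if it has two, moves the two arcs
    between them in opposite directions ([two_fixed_points]).  The invariant measure is used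
    through another one: if F0 is not the identity but has a fixed point, then the measure
    is carried by the fixed points of F0, hence has atoms, and F0 fixes the whole orbit of an
    atom ([fixed_orbit]).  Such an orbit has at most two points modulo 1.

    The map h comes from Hoelder's theorem: a group acting freely on an interval has a
    translation number, an injective order-preserving morphism to R ([holder_morphism],
    [free_order_morphism]), along which the action is semi-conjugate to translations
    ([free_semiconjugacy]).
    - If Gt acts freely on R, then h makes it a group of rotations ([free_has_model]).
    - If a point d has an orbit fixed by F0 and equal to d + Z, consider the stabilizer of d on
      the interval from d to d + 1, which h sends to the affine line, d going to infinity.  If
      the stabilizer has another fixed point c, it acts freely on both sides of c with
      opposite translation numbers tau and - tau, and the exponential turns these into the
      dilations of the two half-lines ([glue]).  Otherwise a theorem of Solodov makes the
      action affine ([solodov]).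
    - If the orbit of d is the union of d + Z and c + Z with d < c < d + 1, an element s that
      sends d to c and c to d + 1 has square the translation by 1 and inverts the stabilizer of
      d; it transports the map h from one side of c to the other, and becomes the rotation by a
      half turn ([swap_has_model]). *)

(** * Translation numbers in bi-ordered groups *)

Section IntegerPowers.
Variables (H : groupType) (t : H).

Definition zpow (m : int) : H :=
  match m with Posz n => (t ^+ n)%g | Negz n => (t ^- n.+1)%g end.

Lemma zpowS m : zpow (m + 1) = (zpow m * t)%g.
Proof.
case: m => n; first by rewrite -PoszD addn1 /= expgSr.
case: n => [|n]; first by rewrite /= expg1 mulVg.
rewrite (_ : Negz n.+1 + 1 = Negz n); last by rewrite !NegzE; lia.
by rewrite /= [in RHS]expgS invgM mulgVK.
Qed.

Lemma zpowB1 m : zpow (m - 1) = (zpow m * t^-1)%g.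
Proof. by rewrite -[in RHS](subrK 1 m) zpowS mulgK. Qed.

Lemma zpowD m n : zpow (m + n) = (zpow m * zpow n)%g.
Proof.
elim/int_ind: n => [|n ih|n ih]; first by rewrite addr0 mulg1.
- by rewrite -addn1 PoszD addrA !zpowS ih mulgA.
- rewrite -addn1 PoszD opprD addrA !zpowB1 ih mulgA //.
Qed.

Lemma zpowN m : zpow (- m) = (zpow m)^-1%g.
Proof. by apply/esym/mulg1_eq; rewrite -zpowD subrr. Qed.

Lemma zpowMn m n : zpow (m * n%:Z) = (zpow m ^+ n)%g.
Proof.
elim: n => [|n ih]; first by rewrite mulr0.
by rewrite -addn1 PoszD mulrDr mulr1 zpowD ih addn1 expgSr.
Qed.
End IntegerPowers.

Definition is_subgroup (H : groupType) (S : set H) :=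
  [/\ S 1%g, forall g k, S g -> S k -> S (g * k)%g & forall g, S g -> S g^-1%g].

Section Subgroup.
Variables (H : groupType) (S : set H) (hS : is_subgroup S).
Lemma subgroup1 : S 1%g. Proof. by case: hS. Qed.
Lemma subgroupM g k : S g -> S k -> S (g * k)%g. Proof. by case: hS => _ + _; apply. Qed.
Lemma subgroupV g : S g -> S g^-1%g. Proof. by case: hS => _ _; apply. Qed.
Lemma subgroupX g n : S g -> S (g ^+ n)%g.
Proof. by move=> Sg; elim: n => [|n ih]; [exact: subgroup1|rewrite expgS; exact: subgroupM]. Qed.
Lemma subgroupZ g m : S g -> S (zpow g m).
Proof. by move=> Sg; case: m => n; [|apply: subgroupV]; exact: subgroupX. Qed.

Variables (R : realType) (tau : H -> R).
Definition additive_on := forall g k, S g -> S k -> tau (g * k)%g = tau g + tau k.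
Hypothesis htau : additive_on.

Lemma additive_on1 : tau 1%g = 0.
Proof. by have := htau subgroup1 subgroup1; rewrite mulg1; lra. Qed.

Lemma additive_onV g : S g -> tau g^-1%g = - tau g.
Proof. by move=> Sg; have := htau Sg (subgroupV Sg); rewrite mulgV additive_on1; lra. Qed.

Lemma additive_onX g n : S g -> tau (g ^+ n)%g = n%:R * tau g.
Proof.
move=> Sg; elim: n => [|n ih]; first by rewrite additive_on1 mul0r.
by rewrite expgS htau// ?ih; [rewrite -natr1; lra|exact: subgroupX].
Qed.

Lemma additive_onZ g m : S g -> tau (zpow g m) = m%:~R * tau g.
Proof.
move=> Sg; case: m => n; first exact: additive_onX.
by rewrite /= additive_onV ?additive_onX ?NegzE ?mulrNz ?mulNr//; exact: subgroupX.
Qed.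
End Subgroup.

(** A preorder suffices for the translation number, so that germs or restrictions of maps can
    be compared without knowing that they determine the map. *)
Record biinvariant_preorder (H : groupType) (S : set H) (le : H -> H -> Prop) := {
  bi_trans : forall g k l, le g k -> le k l -> le g l;
  bi_total : forall g k, S g -> S k -> le g k \/ le k g;
  bi_mull : forall c g k, S c -> le g k -> le (c * g)%g (c * k)%g;
  bi_mulr : forall c g k, S c -> le g k -> le (g * c)%g (k * c)%g }.

Section Holder.
Variables (R : realType) (H : groupType) (S : set H) (le : H -> H -> Prop) (t : H).
Hypotheses (hS : is_subgroup S) (hle : biinvariant_preorder S le).
Hypotheses (St : S t) (t_gt1 : ~ le t 1%g).
Hypothesis cofinal : forall g, S g -> exists n, le g (t ^+ n)%g.

Let S1 := subgroup1 hS.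
Let SM := subgroupM hS.
Let SV := subgroupV hS.
Let SX := subgroupX hS.
Let SZ := subgroupZ hS.
#[local] Hint Resolve S1 SM SV SX SZ St : core.

Let le_refl g : S g -> le g g.
Proof. by move=> Sg; case: (bi_total hle Sg Sg). Qed.

Let leM a b c d : S a -> S b -> S c -> S d -> le a b -> le c d ->
  le (a * c)%g (b * d)%g.
Proof.
move=> Sa Sb Sc Sd ab cd; apply: (bi_trans hle (k := (b * c)%g)).
  exact: (bi_mulr hle).
exact: (bi_mull hle).
Qed.

Let leX a b n : S a -> S b -> le a b -> le (a ^+ n)%g (b ^+ n)%g.
Proof.
move=> Sa Sb ab; elim: n => [|n ih]; first exact: le_refl.
by rewrite !expgS; apply: leM; auto.
Qed.

Let leIl c a b : S c -> le (c * a)%g (c * b)%g -> le a b.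
Proof. by move=> Sc /(bi_mull hle (SV Sc)); rewrite !mulKg. Qed.

Let leV a b : S a -> S b -> le a b -> le b^-1%g a^-1%g.
Proof.
move=> Sa Sb /(bi_mulr hle (SV Sb)); rewrite mulgV.
by move/(bi_mull hle (SV Sa)); rewrite mulg1 mulKg.
Qed.

Let leX_inv a b n : S a -> S b -> le (a ^+ n.+1)%g (b ^+ n.+1)%g -> le a b.
Proof.
move=> Sa Sb abn; case: (bi_total hle Sa Sb) => // ba.
apply: (@leIl (a ^+ n)%g); first by auto.
rewrite -expgSr; apply: (bi_trans hle abn); rewrite expgSr.
by apply: (bi_mulr hle) => //; exact: leX.
Qed.

Let le1t : le 1%g t.
Proof. by case: (bi_total hle S1 St). Qed.

Let le_zpow p q : p <= q -> le (zpow t p) (zpow t q).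
Proof.
move=> pq; rewrite -(subrK p q) addrC zpowD -[X in le X _]mulg1.
apply: (bi_mull hle); auto.
case: (q - p) (subr_ge0 p q) => [n|n]; last by rewrite pq.
by move=> _; rewrite /= -(expg1n H n); apply: leX.
Qed.

Let zpow_le p q : le (zpow t p) (zpow t q) -> p <= q.
Proof.
move=> zpq; rewrite leNgt; apply/negP => qp; apply: t_gt1.
have : le (zpow t (q + 1)) (zpow t (q + 0)).
  rewrite addr0; apply: (bi_trans hle) zpq; apply: le_zpow; lia.
by rewrite !zpowD => /leIl; rewrite /= expg1; apply; auto.
Qed.

Let le_zpowX p q m n g : S g -> p * n.+1%:Z <= q * m.+1%:Z ->
  le (zpow t q) (g ^+ n.+1)%g -> le (zpow t p) (g ^+ m.+1)%g.
Proof.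
move=> Sg pq qn; apply: (@leX_inv _ _ n); [by auto..|].
rewrite -zpowMn -expgnA; apply: (bi_trans hle (le_zpow pq)).
by rewrite zpowMn mulnC expgnA; apply: leX; auto.
Qed.

(** The Dedekind cut of the translation number of g measured with t as a unit. *)
Definition slopes g : set R :=
  [set x | exists p n, x = p%:~R / n.+1%:R /\ le (zpow t p) (g ^+ n.+1)%g].

Let slopes_ub g m : S g -> le g (zpow t m) -> ubound (slopes g) m%:~R.
Proof.
move=> Sg gm _ [p [n [-> pn]]]; rewrite ler_pdivrMr ?ltr0n//.
rewrite -[n.+1%:R]/(n.+1%:Z%:~R) -intrM ler_int; apply: zpow_le.
by rewrite zpowMn; apply: (bi_trans hle pn); apply: leX; auto.
Qed.

Let ex_zpow_ge g : S g -> exists m, le g (zpow t m).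
Proof. by move=> /cofinal [n gn]; exists n%:Z. Qed.

Let slopes0 g : S g -> slopes g !=set0.
Proof.
move=> Sg; have [m gm] := ex_zpow_ge (SV Sg).
exists ((- m)%:~R / 1%:R), (- m), 0%N; split=> //.
by rewrite expg1 zpowN -[X in le _ X]invgK; apply: leV; auto.
Qed.

Let slopes_has_sup g : S g -> has_sup (slopes g).
Proof.
move=> Sg; split; first exact: slopes0.
by have [m gm] := ex_zpow_ge Sg; exists m%:~R; exact: slopes_ub.
Qed.

Definition slope g : R := sup (slopes g).

Let slope_ub g x : S g -> slopes g x -> x <= slope g.
Proof. by move=> Sg; apply: ub_le_sup; case: (slopes_has_sup Sg). Qed.

Let slope_le g y : S g -> (forall x, slopes g x -> x <= y) -> slope g <= y.
Proof. by move=> Sg ub; apply: ge_sup => //; exact: slopes0. Qed.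

(** This is the reason why the slope is additive although the group need not be commutative:
    according to which of gk and kg is the larger, (gk)^n is above g^n k^n or above k^n g^n. *)
Let le_expM g k n a b : S g -> S k -> S a -> S b -> (a * b = b * a)%g ->
  le a (g ^+ n)%g -> le b (k ^+ n)%g -> le (a * b)%g ((g * k) ^+ n)%g.
Proof.
move=> Sg Sk Sa Sb ab an bn.
have swap x y : S x -> S y -> le (x * y)%g (y * x)%g -> forall m,
    le (x ^+ m * y)%g (y * x ^+ m)%g.
  move=> Sx Sy xy; elim=> [|m ih]; first by rewrite mul1g mulg1; apply: le_refl.
  rewrite expgS -mulgA; apply: (bi_trans hle (k := (x * (y * x ^+ m))%g)).
    exact: (bi_mull hle).
  by rewrite !mulgA; apply: (bi_mulr hle); auto.
have group_xy x y : S x -> S y -> le (x * y)%g (y * x)%g -> forall m,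
    le (x ^+ m * y ^+ m)%g ((y * x) ^+ m)%g /\ le (x ^+ m * y ^+ m)%g ((x * y) ^+ m)%g.
  move=> Sx Sy xy; elim=> [|m [ih1 ih2]].
    by rewrite mul1g; split; apply: le_refl.
  split.
    rewrite expgSr [(y ^+ _.+1)%g]expgS -mulgA [((y * x) ^+ _.+1)%g]expgS -mulgA.
    have := swap _ _ Sx Sy xy m.+1.
    rewrite expgSr => /(bi_mulr hle (SX m Sy)).
    rewrite -!mulgA => h; apply: (bi_trans hle h).
    apply: (bi_mull hle) => //; rewrite mulgA -expgSr expgS -mulgA.
    exact: (bi_mull hle).
  rewrite expgS [(y ^+ _.+1)%g]expgS [((x * y) ^+ _.+1)%g]expgS -!mulgA.
  apply: (bi_mull hle) => //; rewrite mulgA.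
  have /(bi_mulr hle (SX m Sy)) := swap _ _ Sx Sy xy m.
  rewrite -!mulgA => h; apply: (bi_trans hle h).
  exact: (bi_mull hle).
have Sgn := SX n Sg; have Skn := SX n Sk.
case: (bi_total hle (SM Sg Sk) (SM Sk Sg)) => [gk|kg].
  by have [_ h] := group_xy _ _ Sg Sk gk n; apply: (bi_trans hle _ h); exact: leM.
by have [h _] := group_xy _ _ Sk Sg kg n; apply: (bi_trans hle _ h); rewrite ab; exact: leM.
Qed.

Let slopeD_ge g k : S g -> S k -> slope g + slope k <= slope (g * k)%g.
Proof.
move=> Sg Sk; rewrite -lerBrDr; apply: slope_le => // x [p [m [xE pm]]].
rewrite lerBrDr -lerBrDl; apply: slope_le => // y [q [n [yE qn]]].
rewrite lerBrDl; apply: slope_ub; auto.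
exists (p * n.+1%:Z + q * m.+1%:Z), (m.+1 * n.+1).-1; split.
  rewrite prednK ?muln_gt0// xE yE addf_div ?pnatr_eq0// natrM.
  by rewrite intrD !intrM.
rewrite prednK ?muln_gt0// zpowD; apply: le_expM; auto.
- by rewrite -!zpowD addrC.
- by rewrite zpowMn expgnA; apply: leX; auto.
- by rewrite zpowMn mulnC expgnA; apply: leX; auto.
Qed.

Let slope1 : slope 1%g = 0.
Proof.
apply/eqP; rewrite eq_le; apply/andP; split.
  apply: slope_le => // x; apply: (@slopes_ub 1%g 0) => //; exact: le_refl.
apply: slope_ub => //; exists 0, 0%N; rewrite mul0r; split=> //.
by rewrite expg1; apply: le_refl.
Qed.

Let slopeV_ge g : S g -> - slope g <= slope g^-1%g.
Proof.
move=> Sg; rewrite lerNl leNgt; apply/negP => /rat_in_itvoo [q].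
rewrite in_itv /= => /andP[q1 q2].
have [n dE] : exists n, denq q = n.+1%:Z.
  by exists `|denq q|.-1%N; have := denq_gt0 q; case: (denq q) => // -[].
have qE : ratr q = (numq q)%:~R / n.+1%:R :> R by rewrite /ratr dE.
have qN : ~ le (zpow t (numq q)) (g ^+ n.+1)%g.
  move=> h; suff : ratr q <= slope g by rewrite leNgt q1.
  by apply: slope_ub => //; exists (numq q), n.
suff : - ratr q <= slope g^-1%g by rewrite lerNl leNgt q2.
apply: slope_ub; auto; exists (- numq q), n; split.
  by rewrite qE mulrNz mulNr.
rewrite zpowN expVgn; apply: leV; auto.
by case: (bi_total hle (SZ (numq q) St) (SX n.+1 Sg)).
Qed.

Let slopeD g k : S g -> S k -> slope (g * k)%g = slope g + slope k.
Proof.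
move=> Sg Sk; apply/eqP; rewrite eq_le slopeD_ge// andbT.
have := slopeD_ge (SM Sg Sk) (SV Sk); rewrite mulgK.
have := slopeV_ge Sk; lra.
Qed.

Let slopet : slope t = 1.
Proof.
have tE : t = zpow t 1 by rewrite /= expg1.
apply/eqP; rewrite eq_le; apply/andP; split.
  apply: slope_le => // x; apply: (@slopes_ub t 1) => //.
  by rewrite -tE; exact: le_refl.
apply: slope_ub => //; exists 1, 0%N; rewrite divr1; split=> //.
by rewrite expg1 -tE; exact: le_refl.
Qed.

(** Hoelder's theorem: a positive element t with cofinal powers measures the whole group.  The
    slope is superadditive and the slopes of g and of its inverse are opposite, hence it is
    additive. *)
Lemma holder_morphism : exists tau : H -> R,
  [/\ additive_on S tau, tau t = 1 &
      forall g k, S g -> S k -> le g k -> tau g <= tau k].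
Proof.
exists slope; split=> // g k Sg Sk gk; apply: slope_le => // x [p [n [xE pn]]].
apply: slope_ub => //; exists p, n; split=> //.
by apply: (bi_trans hle pn); exact: leX.
Qed.
End Holder.

(** * Free actions on an interval *)

Record line_action (R : realType) (H : groupType) (a : H -> R -> R) := {
  act1 : forall x, a 1%g x = x;
  actM : forall g k x, a (g * k)%g x = a g (a k x);
  act_lt : forall g x y, x < y -> a g x < a g y }.

Section LineAction.
Variables (R : realType) (H : groupType) (a : H -> R -> R).
Hypothesis ha : line_action a.

Lemma act_ltE g x y : (a g x < a g y) = (x < y).
Proof. by apply: leW_mono; apply: le_mono; exact: act_lt ha g. Qed.

Lemma act_leE g x y : (a g x <= a g y) = (x <= y).
Proof. by rewrite !leNgt act_ltE. Qed.

Lemma actVK g x : a g^-1%g (a g x) = x.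
Proof. by rewrite -(actM ha) mulVg (act1 ha). Qed.

Lemma actKV g x : a g (a g^-1%g x) = x.
Proof. by rewrite -(actM ha) mulgV (act1 ha). Qed.

Lemma act_inj g : injective (a g).
Proof. exact: can_inj (actVK g). Qed.

Lemma actV_lt g x y : (a g^-1%g x < y) = (x < a g y).
Proof. by rewrite -(act_ltE g) actKV. Qed.

Lemma lt_actV g x y : (y < a g^-1%g x) = (a g y < x).
Proof. by rewrite -(act_ltE g) actKV. Qed.

Lemma actV_fix g x : a g x = x -> a g^-1%g x = x.
Proof. by move=> gx; rewrite -[in LHS]gx actVK. Qed.

Lemma actV_eq g x y : a g x = y -> a g^-1%g y = x.
Proof. by move=> <-; exact: actVK. Qed.

Lemma actX_fix g x n : a g x = x -> a (g ^+ n)%g x = x.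
Proof.
by move=> gx; elim: n => [|n ih]; rewrite ?(act1 ha)// expgS (actM ha) ih.
Qed.

(** The supremum of a bounded orbit would be fixed. *)
Lemma orbit_unbounded (J : set R) g x y : is_interval J ->
  (forall z, J z -> J (a g z)) -> (forall z, J z -> z < a g z) ->
  J x -> J y -> exists n, y < a (g ^+ n)%g x.
Proof.
move=> intJ Jg gup Jx Jy; apply/not_existsP => noub.
pose O := [set z | exists n, z = a (g ^+ n)%g x].
have Ox : O x by exists 0%N; rewrite (act1 ha).
have ubO : ubound O y by move=> _ [n ->]; rewrite leNgt; apply/negP/noub.
have supO : has_sup O by split; [exists x|exists y].
have Js : J (sup O).
  by apply: (intJ x y) => //; rewrite ub_le_sup ?ge_sup//; [exists x|exists y].
have : a g^-1%g (sup O) < sup O by rewrite actV_lt; exact: gup.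
move=> /(sup_gt supO.1) [_ [n ->]]; rewrite actV_lt ltNge => /negP; apply.
by apply: ub_le_sup; [exists y|exists n.+1; rewrite expgS (actM ha)].
Qed.

Lemma orbit_lower (J : set R) g x y : is_interval J ->
  (forall z, J z -> J (a g z)) -> (forall z, J z -> z < a g z) ->
  J x -> J y -> exists n, a (g ^- n)%g x < y.
Proof.
move=> intJ Jg gup Jx Jy; have [n xn] := orbit_unbounded intJ Jg gup Jy Jx.
by exists n; rewrite actV_lt.
Qed.

(** Values of u at x and y are compared along the orbits, which exceed any point of J. *)
Lemma invariant_constant d (T : porderType d) (J : set R) g (u : R -> T) x y :
  is_interval J -> (forall z, J z -> J (a g z)) -> (forall z, J z -> z < a g z) ->
  {in J &, {homo u : x y / x <= y >-> (x <= y)%O}} ->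
  (forall z, J z -> u (a g z) = u z) -> J x -> J y -> u x = u y.
Proof.
move=> intJ Jg gup u_nd ug Jx Jy.
have JX z n : J z -> J (a (g ^+ n)%g z).
  by move=> Jz; elim: n => [|n ih]; rewrite ?(act1 ha)// expgS (actM ha); exact: Jg.
have uX z n : J z -> u (a (g ^+ n)%g z) = u z.
  move=> Jz; elim: n => [|n ih]; first by rewrite (act1 ha).
  by rewrite expgS (actM ha) ug ?ih//; exact: JX.
suff le_u z w : J z -> J w -> (u z <= u w)%O.
  by apply: le_anti; rewrite !le_u.
move=> Jz Jw; have [n /ltW zn] := orbit_unbounded intJ Jg gup Jw Jz.
by rewrite -(uX w n)//; apply: u_nd => //; apply/mem_set => //; exact: JX.
Qed.

(** The supremum of the points of [x, y] that g moves up is fixed, as g preserves the order. *)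
Lemma act_ivt g x y : x < y -> x < a g x -> a g y < y ->
  exists2 z, x < z < y & a g z = z.
Proof.
move=> xy gx gy.
pose A := [set z | [/\ x <= z, z <= y & z < a g z]].
have Ax : A x by split=> //; exact: ltW.
have ubA : ubound A y by move=> z [].
have supA : has_sup A by split; [exists x|exists y].
have xs : x <= sup A by apply: ub_le_sup => //; exists y.
have sy : sup A <= y by apply: ge_sup => //; exists x.
have fixs : a g (sup A) = sup A.
  apply/eqP; rewrite eq_le; apply/andP; split; rewrite leNgt; apply/negP => h.
    have {}sy : sup A < y.
      by rewrite lt_neqAle sy andbT; apply/eqP => e; move: h; rewrite e; lra.
    have [z /andP[sz zlt]] : exists z, sup A < z < Num.min y (a g (sup A)).
      by exists ((sup A + Num.min y (a g (sup A))) / 2); rewrite !midf_lt// lt_min sy.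
    move: zlt; rewrite lt_min => /andP[zy zs].
    suff : z <= sup A by rewrite leNgt sz.
    apply: ub_le_sup; first by exists y.
    split; [lra|lra|]; apply: (lt_trans zs); by rewrite act_ltE.
  have [z [xz zy gz] sz] := sup_gt supA.1 h.
  have : z <= sup A by apply: ub_le_sup; [exists y|].
  by rewrite -(act_leE g) => ?; lra.
exists (sup A) => //; rewrite !lt_neqAle xs sy !andbT.
apply/andP; split; apply/eqP => e.
  by move: gx; rewrite e fixs ltxx.
by move: gy; rewrite -e fixs ltxx.
Qed.

Lemma act_sign (J : set R) g : is_interval J -> (forall x, J x -> a g x <> x) ->
  (forall x, J x -> x < a g x) \/ (forall x, J x -> a g x < x).
Proof.
move=> intJ nofix.
have ivt k x y : (forall z, J z -> a k z <> z) -> J x -> J y ->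
    x < y -> x < a k x -> y < a k y.
  move=> knofix Jx Jy xy kx; rewrite ltNge le_eqVlt; apply/negP => /predU1P[|ky].
    exact: knofix.
  have [z /andP[xz zy]] := act_ivt xy kx ky.
  by apply: knofix; apply: (intJ x y) => //; rewrite !ltW.
have nofixV x : J x -> a g^-1%g x <> x.
  by move=> Jx gx; apply: (nofix x Jx); rewrite -[in LHS]gx actKV.
have [[x Jx xg]|noup] := pselect (exists2 x, J x & x < a g x); last first.
  right=> x Jx; rewrite ltNge le_eqVlt; apply/negP => /predU1P[|xg].
    by move=> e; apply: (nofix x Jx).
  by apply: noup; exists x.
left=> y Jy; have [yx|xy|->//] := ltgtP y x; last exact: (ivt g x).
rewrite ltNge le_eqVlt; apply/negP => /predU1P[|gy]; first exact: nofix.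
have : x < a g^-1%g x by apply: (ivt _ y) => //; rewrite lt_actV.
by rewrite lt_actV; lra.
Qed.

Definition acts_freely (S : set H) (J : set R) :=
  (forall g x, S g -> J x -> J (a g x)) /\
  (forall g, S g -> [\/ g = 1%g, forall x, J x -> x < a g x |
                                 forall x, J x -> a g x < x]).

(** Translation numbers of a free action, with an arbitrary unit. *)
Definition order_morphism (S : set H) (J : set R) (tau : H -> R) :=
  additive_on S tau /\
  (forall g x, S g -> J x -> x < a g x -> 0 < tau g).

(** On a free action the comparison of two elements at one point is their comparison at all
    points, which is a bi-invariant total order, archimedean because orbits are unbounded. *)
Lemma free_order_morphism (S : set H) (J : set R) t x0 :
  is_subgroup S -> acts_freely S J -> is_interval J ->
  S t -> J x0 -> x0 < a t x0 -> exists tau, order_morphism S J tau.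
Proof.
move=> hS [SJ free] intJ St Jx0 tx0.
have up g x : S g -> J x -> x < a g x -> forall z, J z -> z < a g z.
  move=> Sg Jx xg; case: (free g Sg) => // [g1|gd].
    by move: xg; rewrite g1 (act1 ha) ltxx.
  by move: xg; rewrite ltNge ltW//; exact: gd.
have t_up := up _ _ St Jx0 tx0.
pose le g k := forall x, J x -> a g x <= a k x.
have hle : biinvariant_preorder S le.
  split.
  - by move=> g k l gk kl x Jx; apply: le_trans (gk _ Jx) (kl _ Jx).
  - move=> g k Sg Sk.
    case: (free (g^-1 * k)%g (subgroupM hS (subgroupV hS Sg) Sk)) => [e|e|e].
    + by left => x _; rewrite -[k](mulVKg g) e mulg1.
    + left => x Jx; move: (ltW (e _ Jx)); rewrite (actM ha).
      by rewrite -(act_leE g) actKV.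
    + right => x Jx; move: (ltW (e _ Jx)); rewrite (actM ha).
      by rewrite -(act_leE g) actKV.
  - by move=> c g k Sc gk x Jx; rewrite !(actM ha) act_leE; exact: gk.
  - by move=> c g k Sc gk x Jx; rewrite !(actM ha); apply: gk; exact: SJ.
have below g k x : S g -> S k -> J x -> a g x < a k x -> le g k.
  move=> Sg Sk Jx gk z Jz.
  have := up (g^-1 * k)%g x (subgroupM hS (subgroupV hS Sg) Sk) Jx.
  by rewrite (actM ha) lt_actV gk => /(_ isT z Jz); rewrite (actM ha) lt_actV => /ltW.
have cof g k : S g -> S k -> (forall z, J z -> z < a k z) ->
    exists n, le g (k ^+ n)%g.
  move=> Sg Sk kup.
  have [n gn] := orbit_unbounded intJ (fun z => SJ k z Sk) kup Jx0 (SJ _ _ Sg Jx0).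
  by exists n; apply: below gn => //; exact: subgroupX.
have t_gt1 : ~ le t 1%g by move=> /(_ _ Jx0); rewrite (act1 ha); lra.
have cof_t g (Sg : S g) := cof g t Sg St t_up.
have [tau [tauM tau_t tau_le]] := holder_morphism R hS hle St t_gt1 cof_t.
exists tau; split=> // g x Sg Jx gx.
have [n tn] := cof t g St Sg (up _ _ Sg Jx gx).
have := tau_le _ _ St (subgroupX hS n Sg) tn; rewrite tau_t (additive_onX hS tauM)//.
by apply: contraTT; rewrite -!leNgt -ltNge => ?; apply: le_lt_trans ltr01;
  rewrite mulr_ge0_le0.
Qed.

Section OrderMorphism.
Variables (S : set H) (J : set R) (tau : H -> R).
Hypotheses (hS : is_subgroup S) (free : acts_freely S J) (htau : order_morphism S J tau).

Let tau1 := additive_on1 hS htau.1.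
Let tauV := additive_onV hS htau.1.
Let tauZ := additive_onZ hS htau.1.

Lemma tau_pos g x : S g -> J x -> (x < a g x) = (0 < tau g).
Proof.
move=> Sg Jx; apply/idP/idP; first exact: htau.2.
case: (free.2 g Sg) => [->|gup _|gd]; [by rewrite tau1 ltxx|exact: gup|].
have : 0 < tau g^-1%g.
  by apply: (htau.2 _ x) => //; [exact: subgroupV|rewrite lt_actV; exact: gd].
by rewrite tauV//; lra.
Qed.

Lemma tau_lt g k x : S g -> S k -> J x -> (a g x < a k x) = (tau g < tau k).
Proof.
move=> Sg Sk Jx.
rewrite -lt_actV -(actM ha) tau_pos//; last exact: subgroupM (subgroupV hS Sg) Sk.
by rewrite htau.1 ?tauV//; [lra|exact: subgroupV].
Qed.

Lemma tau_inj g k : S g -> S k -> J !=set0 -> tau g = tau k -> g = k.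
Proof.
move=> Sg Sk [x Jx] e; apply/esym/divg1_eq.
have SkV : S (k * g^-1)%g by apply: (subgroupM hS) => //; exact: subgroupV.
have t0 : tau (k * g^-1)%g = 0 by rewrite htau.1 ?tauV//; [lra|exact: subgroupV].
case: (free.2 _ SkV) => // h.
  by have := h _ Jx; rewrite tau_pos// t0 ltxx.
have := h _ Jx; rewrite -lt_actV tau_pos//; last exact: subgroupV.
by rewrite tauV// t0 oppr0 ltxx.
Qed.

Lemma tau_dense x y : x < y -> (forall e, 0 < e -> exists2 g, S g & 0 < tau g < e) ->
  exists2 g, S g & x < tau g < y.
Proof.
move=> xy small; have [g Sg /andP[g0 ge]] := small (y - x) ltac:(lra).
exists (zpow g (Num.floor (x / tau g) + 1)); first exact: subgroupZ.
rewrite tauZ//; apply/andP; split.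
  by rewrite -ltr_pdivrMr// floorD1_gt.
have : (Num.floor (x / tau g))%:~R * tau g <= x.
  by rewrite -ler_pdivlMr//; exact: floor_le.
by rewrite intrD; lra.
Qed.

Definition semiconjugates (theta : R -> R) :=
  [/\ {in J &, {homo theta : x y / x <= y}},
      forall r, exists2 x, J x & theta x = r &
      forall g x, S g -> J x -> theta (a g x) = theta x + tau g].

Hypotheses (intJ : is_interval J).

Let JM g x : S g -> J x -> J (a g x) := @free.1 g x.

(** When tau has dense image, theta x is the supremum of the translation numbers of the elements
    that send y0 below x; density makes it onto. *)
Lemma dense_semiconjugacy y0 :
  J y0 -> (forall e, 0 < e -> exists2 g, S g & 0 < tau g < e) ->
  exists theta, semiconjugates theta.
Proof.
move=> Jy0 small.
have [t St /andP[t0 _]] := small 1 ltr01.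
have t_up x : J x -> x < a t x by move=> Jx; rewrite tau_pos.
pose A x := [set r | exists2 g, S g /\ a g y0 <= x & r = tau g].
have A0 x : J x -> A x !=set0.
  move=> Jx; have [n xn] := orbit_lower intJ (fun z => JM St) t_up Jy0 Jx.
  exists (tau (t ^- n)%g), (t ^- n)%g => //; split; last exact: ltW.
  by apply: (subgroupV hS); exact: subgroupX.
have Aub x : J x -> has_ubound (A x).
  move=> Jx; have [n xn] := orbit_unbounded intJ (fun z => JM St) t_up Jy0 Jx.
  exists (tau (t ^+ n)%g) => _ [g [Sg gx] ->].
  by apply/ltW; rewrite -(@tau_lt _ _ y0)//; [exact: le_lt_trans xn|exact: subgroupX].
have supA x : J x -> has_sup (A x) by move=> Jx; split; [exact: A0|exact: Aub].
exists (sup \o A); split.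
- move=> x y; rewrite !inE => Jx Jy xy; apply: ge_sup; first exact: A0.
  move=> _ [g [Sg gx] ->]; apply: ub_le_sup; first exact: Aub.
  by exists g => //; split=> //; exact: le_trans xy.
- move=> r.
  pose B := [set z | exists2 g, S g /\ tau g <= r & z = a g y0].
  have [g1 Sg1 /andP[_ g1r]] := tau_dense (x := r - 1) (y := r) ltac:(lra) small.
  have [g2 Sg2 /andP[g2r _]] := tau_dense (x := r) (y := r + 1) ltac:(lra) small.
  have B1 : B (a g1 y0) by exists g1 => //; split=> //; exact: ltW.
  have Bub g : S g -> r < tau g -> ubound B (a g y0).
    move=> Sg rg _ [k [Sk kr] ->]; apply/ltW; rewrite tau_lt//.
    exact: le_lt_trans rg.
  have hubB : has_ubound B by exists (a g2 y0); exact: Bub.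
  have Js : J (sup B).
    apply: (intJ (JM Sg1 Jy0) (JM Sg2 Jy0)).
    by rewrite ub_le_sup ?ge_sup//; [exists (a g1 y0)|exact: Bub].
  exists (sup B) => //=; apply/eqP; rewrite eq_le; apply/andP; split.
    apply: ge_sup; first exact: A0.
    move=> _ [g [Sg gs] ->]; rewrite leNgt; apply/negP => rg.
    have [k Sk /andP[rk kg]] := tau_dense rg small.
    have : a k y0 < sup B by apply: lt_le_trans gs; rewrite tau_lt.
    by rewrite ltNge ge_sup//; [exists (a g1 y0)|exact: Bub].
  rewrite leNgt; apply/negP => sr.
  have [k Sk /andP[sk kr]] := tau_dense sr small.
  suff : tau k <= sup (A (sup B)) by rewrite leNgt sk.
  apply: ub_le_sup; first exact: Aub.
  exists k => //; split=> //; apply: ub_le_sup => //.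
  by exists k => //; split=> //; exact: ltW.
have ge g x : S g -> J x -> sup (A x) + tau g <= sup (A (a g x)).
  move=> Sg Jx; rewrite -lerBrDr; apply: ge_sup; first exact: A0.
  move=> _ [k [Sk kx] ->]; rewrite lerBrDr; apply: ub_le_sup.
    by apply: Aub; exact: JM.
  exists (g * k)%g; last by rewrite htau.1// addrC.
  by split; [exact: subgroupM|rewrite (actM ha) act_leE].
move=> g x Sg Jx /=; apply/eqP; rewrite eq_le ge// andbT.
have := ge g^-1%g (a g x) (subgroupV hS Sg) (JM Sg Jx).
by rewrite actVK tauV//; lra.
Qed.

(** When tau has a least positive value, the group is generated by one element g1, and any
    increasing map of the fundamental domain from y0 to its image extends equivariantly; theta
    is affine there. *)
Lemma discrete_semiconjugacy y0 g1 :
  J y0 -> S g1 -> 0 < tau g1 -> (forall g, S g -> 0 < tau g -> tau g1 <= tau g) ->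
  exists theta, semiconjugates theta.
Proof.
move=> Jy0 Sg1 g1_gt0 g1_min.
have g1_up x : J x -> x < a g1 x by move=> Jx; rewrite tau_pos.
have SZ m : S (zpow g1 m) by exact: subgroupZ.
pose dom z := y0 <= z < a g1 y0.
have Jdom z : dom z -> J z.
  by move=> /andP[z1 z2]; apply: (intJ Jy0 (JM Sg1 Jy0)); rewrite z1 ltW.
have zpow_lt m n : (a (zpow g1 m) y0 < a (zpow g1 n) y0) = (m < n).
  by rewrite tau_lt// !tauZ// ltr_pM2r// ltr_int.
have decomp x : J x -> exists mz : int * R, dom mz.2 /\ x = a (zpow g1 mz.1) mz.2.
  move=> Jx; have [n0 xn0] := orbit_lower intJ (fun z => JM Sg1) g1_up Jy0 Jx.
  have ex : exists n, x < a (zpow g1 (n%:Z + 1 - n0%:Z)) y0.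
    have [n xn] := orbit_unbounded intJ (fun z => JM Sg1) g1_up Jy0 Jx.
    exists (n0 + n)%N; apply: (lt_trans xn).
    by rewrite (_ : a (g1 ^+ n)%g y0 = a (zpow g1 n) y0)// zpow_lt; lia.
  case: (ex_minnP ex) => n xn nmin.
  pose m := n%:Z - n0%:Z.
  exists (m, a (zpow g1 (- m)) x); split; last by rewrite /= zpowN actKV.
  rewrite /dom /= zpowN leNgt !actV_lt -(actM ha); apply/andP; split; last first.
    rewrite -[X in (_ * X)%g]/(zpow g1 1) -zpowD.
    by rewrite (_ : m + 1 = n%:Z + 1 - n0%:Z)// /m; lia.
  rewrite -leNgt; case: n xn nmin @m => [|n] xn nmin m.
    by rewrite /m sub0r zpowN /= ltW.
  rewrite leNgt; apply/negP => h; have := nmin n.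
  rewrite (_ : n%:Z + 1 - n0%:Z = m); last by rewrite /m; lia.
  by move=> /(_ h); rewrite ltnn.
pose d := a g1 y0 - y0.
have d_gt0 : 0 < d by have := g1_up _ Jy0; rewrite /d; lra.
pose val (mz : int * R) := tau g1 * (mz.1%:~R + (mz.2 - y0) / d).
have frac z : dom z -> 0 <= (z - y0) / d < 1.
  move=> /andP[z0 z1]; rewrite divr_ge0 ?ltr_pdivrMr//= /d; lra.
have val_le m z m' z' : dom z -> dom z' ->
    a (zpow g1 m) z <= a (zpow g1 m') z' -> val (m, z) <= val (m', z').
  move=> dz dz' zz'; rewrite /val ler_pM2l//=.
  have [mm'|m'm|mE] := ltgtP m m'.
  - have := frac _ dz; have := frac _ dz'; have : m%:~R + 1 <= m'%:~R :> R.
      by rewrite -[1]/(1%:~R) -intrD ler_int; lia.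
    lra.
  - exfalso; move: zz'; apply/negP; rewrite -ltNge.
    move: dz dz' => /andP[z1 _] /andP[_ z2].
    apply: (@lt_le_trans _ _ (a (zpow g1 (m' + 1)) y0)).
      by rewrite zpowS (actM ha) act_ltE.
    apply: (@le_trans _ _ (a (zpow g1 m) y0)); last by rewrite act_leE.
    by rewrite leNgt zpow_lt; lia.
  - by move: zz'; rewrite mE act_leE lerD2l ler_pM2r ?invr_gt0//; lra.
pose theta x := if pselect (J x) is left Jx then val (sval (cid (decomp x Jx))) else 0.
have thetaE m z : dom z -> theta (a (zpow g1 m) z) = val (m, z).
  move=> dz; rewrite /theta; case: pselect => [Jx|]; last by case; apply: JM => //; exact: Jdom.
  case: cid => -[m' z'] /= [dz' e]; apply/eqP; rewrite eq_le.
  by rewrite !val_le// -e lexx.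
exists theta; split.
- move=> x y; rewrite !inE => Jx Jy xy.
  have [[m z] /= [dz xE]] := decomp _ Jx; have [[m' z'] /= [dz' yE]] := decomp _ Jy.
  by rewrite xE yE !thetaE// val_le// -xE -yE.
- move=> r; pose m := Num.floor (r / tau g1).
  pose f := r / tau g1 - m%:~R.
  have f0 : 0 <= f by rewrite subr_ge0; exact: floor_le.
  have f1 : f < 1 by have := floorD1_gt (r / tau g1); rewrite -/m intrD /f; lra.
  have dz : dom (y0 + f * d).
    apply/andP; split; first by rewrite lerDl mulr_ge0// ltW.
    have : f * d < 1 * d by rewrite ltr_pM2r.
    by rewrite mul1r /d; lra.
  exists (a (zpow g1 m) (y0 + f * d)); first by apply: JM => //; exact: Jdom.
  rewrite thetaE// /val /= addrAC subrr add0r mulfK ?gt_eqF// /f subrKC.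
  by rewrite mulrC divfK// gt_eqF.
- move=> g x Sg Jx; have [[m z] /= [dz xE]] := decomp _ Jx.
  pose k := Num.floor (tau g / tau g1).
  have gE : g = zpow g1 k.
    have k1 : k%:~R * tau g1 <= tau g by rewrite -ler_pdivlMr//; exact: floor_le.
    have k2 : tau g < (k%:~R + 1) * tau g1.
      by rewrite -ltr_pdivrMr// -[1]/(1%:~R) -intrD floorD1_gt.
    apply: tau_inj => //; [by exists y0|rewrite tauZ//].
    apply/eqP; rewrite eq_le k1 andbT leNgt; apply/negP => lt.
    have SgZ : S (g * (zpow g1 k)^-1)%g by apply: (subgroupM hS) => //; exact: subgroupV.
    have tE : tau (g * (zpow g1 k)^-1)%g = tau g - k%:~R * tau g1.
      by rewrite htau.1 ?tauV ?tauZ//; exact: subgroupV.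
    by have := g1_min _ SgZ; rewrite tE; lra.
  rewrite xE gE -(actM ha) -zpowD !thetaE// tauZ// /val /= intrD; lra.
Qed.

Lemma order_morphism_dichotomy y0 t : J y0 -> S t -> y0 < a t y0 ->
  (forall e, 0 < e -> exists2 g, S g & 0 < tau g < e) \/
  (exists g1, [/\ S g1, 0 < tau g1 & forall g, S g -> 0 < tau g -> tau g1 <= tau g]).
Proof.
move=> Jy0 St; rewrite tau_pos// => t0.
have [small|] := pselect (forall e, 0 < e -> exists2 g, S g & 0 < tau g < e).
  by left.
move=> /existsNP[e /not_implyP[e0 noe]]; right.
pose P := [set r | exists2 g, S g /\ 0 < tau g & r = tau g].
have Pe : lbound P e.
  move=> _ [g [Sg g0] ->]; rewrite leNgt; apply/negP => ge; apply: noe.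
  by exists g => //; rewrite g0.
have infP : has_inf P by split; [exists (tau t), t|exists e].
have c0 : 0 < inf P by apply: (lt_le_trans e0); apply: lb_le_inf => //; case: infP.
have Pmin g : S g -> 0 < tau g -> inf P <= tau g.
  by move=> Sg g0; apply: ge_inf; [exists e|exists g].
have [_ [g1 [Sg1 g10] ->] g1c] := inf_adherent c0 infP.
exists g1; split=> // g Sg g0.
rewrite leNgt; apply/negP => lt.
have SgV : S (g1 * g^-1)%g by apply: (subgroupM hS) => //; exact: subgroupV.
have tE : tau (g1 * g^-1)%g = tau g1 - tau g by rewrite htau.1 ?tauV//; exact: subgroupV.
by have := Pmin _ SgV; have := Pmin _ Sg g0; rewrite tE; lra.
Qed.

Lemma free_semiconjugacy y0 t : J y0 -> S t -> y0 < a t y0 ->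
  exists theta, semiconjugates theta.
Proof.
move=> Jy0 St tup; have [small|[g1 [Sg1 g10 g1min]]] := order_morphism_dichotomy Jy0 St tup.
  exact: dense_semiconjugacy Jy0 small.
exact: (discrete_semiconjugacy Jy0 Sg1 g10).
Qed.

(** Dense translations of the line determine their semi-conjugacy up to a constant; hence an
    element normalizing the group acts by an affine map. *)
Lemma dense_semiconjugacy_unique theta theta' :
  (forall e, 0 < e -> exists2 g, S g & 0 < tau g < e) ->
  {in J &, {homo theta : x y / x <= y}} -> {in J &, {homo theta' : x y / x <= y}} ->
  (forall g x, S g -> J x -> theta (a g x) = theta x + tau g) ->
  (forall g x, S g -> J x -> theta' (a g x) = theta' x + tau g) ->
  forall x y, J x -> J y -> theta y - theta x = theta' y - theta' x.
Proof.
move=> small.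
suff le t t' : {in J &, {homo t : x y / x <= y}} ->
    {in J &, {homo t' : x y / x <= y}} ->
    (forall g x, S g -> J x -> t (a g x) = t x + tau g) ->
    (forall g x, S g -> J x -> t' (a g x) = t' x + tau g) ->
    forall x y, J x -> J y -> t y - t x <= t' y - t' x.
  by move=> nd nd' eq eq' x y Jx Jy; apply/eqP; rewrite eq_le !le.
move=> nd nd' eq eq' x y Jx Jy; rewrite leNgt; apply/negP => lt.
have [g Sg /andP[g1 g2]] := tau_dense lt small.
have Jgx := JM Sg Jx.
have : a g x <= y.
  rewrite leNgt; apply/negP => /ltW ygx.
  by have := nd _ _ (mem_set Jy) (mem_set Jgx) ygx; rewrite eq//; lra.
by move=> /(nd' _ _ (mem_set Jgx) (mem_set Jy)); rewrite eq'//; lra.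
Qed.

End OrderMorphism.

(** The uniqueness part of Hoelder's theorem. *)
Lemma order_morphism_proportional (S : set H) (J : set R) sigma tau g k :
  is_subgroup S -> acts_freely S J -> J !=set0 ->
  order_morphism S J sigma -> order_morphism S J tau ->
  S g -> S k -> 0 < tau k -> sigma g * tau k = sigma k * tau g.
Proof.
move=> hS free [x Jx] hsigma htau Sg Sk tk.
have pos f f' l : order_morphism S J f -> order_morphism S J f' ->
    S l -> 0 < f' l -> 0 < f l.
  by move=> hf hf' Sl; rewrite -(tau_pos hS free hf' Sl Jx) (tau_pos hS free hf Sl Jx).
(* for p / n between the two quotients, f and f' have opposite signs on g^n k^-p *)
have sep f f' : order_morphism S J f -> order_morphism S J f' ->
    0 < f k -> 0 < f' k -> f' g / f' k <= f g / f k.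
  move=> hf hf' fk fk'; rewrite leNgt; apply/negP => /rat_in_itvoo [q].
  rewrite in_itv /= => /andP[].
  have [n dE] : exists n, denq q = n.+1%:Z.
    by exists `|denq q|.-1%N; have := denq_gt0 q; case: (denq q) => // -[].
  rewrite ltr_pdivrMr// ltr_pdivlMr// /ratr dE -[n.+1%:~R]/(n.+1%:R).
  rewrite ![_ / n.+1%:R * _]mulrAC ltr_pdivlMr ?ltr0n// ltr_pdivrMr ?ltr0n// => q1 q2.
  have Sl : S (g ^+ n.+1 * zpow k (- numq q))%g.
    by apply: (subgroupM hS); [exact: subgroupX|exact: subgroupZ].
  have fl h : order_morphism S J h ->
      h (g ^+ n.+1 * zpow k (- numq q))%g = n.+1%:R * h g - (numq q)%:~R * h k.
    move=> hh; rewrite hh.1; [|exact: subgroupX|exact: subgroupZ].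
    by rewrite (additive_onX hS hh.1)// (additive_onZ hS hh.1)// mulrNz mulNr.
  by have := pos _ _ _ hf hf' Sl; rewrite !fl//; lra.
have sk := pos _ _ _ hsigma htau Sk tk.
have e : sigma g / sigma k == tau g / tau k by rewrite eq_le !sep.
by move: e; rewrite eqr_div ?lt0r_neq0// mulrC [tau g * _]mulrC => /eqP <-; rewrite mulrC.
Qed.

End LineAction.

(** * Groups of affine type on an interval *)

Section Solodov.
Variables (R : realType) (H : groupType) (a : H -> R -> R) (ha : line_action a).
Variables (S : set H) (l r : R).
Hypothesis hS : is_subgroup S.

Let J := [set x | l < x < r].

Definition moves_up g := forall x, J x -> x < a g x.

Definition expands g c :=
  [/\ J c, a g c = c, forall x, l < x < c -> a g x < x & forall x, c < x < r -> x < a g x].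

(** The trace on the order of a group of affine maps: a fixed point of a nontrivial element
    is either repelling or attracting on both sides. *)
Definition affine_like := (forall g x, S g -> J x -> J (a g x)) /\
  (forall g c, S g -> J c -> a g c = c -> [\/ g = 1%g, expands g c | expands g^-1%g c]).

Hypothesis hA : affine_like.

Let S1 := subgroup1 hS.
Let SM := subgroupM hS.
Let SV := subgroupV hS.
Let SX := subgroupX hS.
Let JM g x : S g -> J x -> J (a g x) := @hA.1 g x.
#[local] Hint Resolve S1 SM SV SX : core.

Lemma is_interval_open : is_interval J.
Proof. by move=> x y /andP[lx _] /andP[_ yr] z /andP[xz zy]; rewrite /J/=; lra. Qed.
Let intJ := is_interval_open.

Variant action_type g : Prop :=
| Trivial of g = 1%g
| Up of moves_up g
| Down of moves_up g^-1%g
| Expanding c of expands g c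
| Contracting c of expands g^-1%g c.

Lemma action_typeP g : S g -> action_type g.
Proof.
move=> Sg; have [[c [Jc gc]]|nofix] := pselect (exists c, J c /\ a g c = c).
  by case: (hA.2 g c Sg Jc gc) => h; [exact: Trivial|exact: Expanding h|exact: Contracting h].
have {}nofix x : J x -> a g x <> x by move=> Jx gx; apply: nofix; exists x.
have [up|down] := act_sign ha intJ nofix; first exact: Up.
by apply: Down => x Jx; rewrite (lt_actV ha); exact: down.
Qed.

Lemma expands_lt g c x : expands g c -> J x -> (x < a g x) = (c < x).
Proof.
move=> [Jc gc gl gr] /andP[lx xr]; have [cx|xc|<-] := ltgtP c x.
- by apply: gr; rewrite cx.
- by apply/negbTE; rewrite -leNgt ltW//; apply: gl; rewrite lx.
- by rewrite gc ltxx.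
Qed.

Lemma expands_conj g h c : S g -> expands h c ->
  expands (g * h * g^-1)%g (a g c).
Proof.
move=> Sg hc; have [Jc hcc hl hr] := hc; split.
- exact: JM.
- by rewrite !(actM ha) (actVK ha) hcc.
- move=> x /andP[lx xc].
  have Jx : J x by have /andP[_ ?] := JM Sg Jc; rewrite /J/=; lra.
  rewrite !(actM ha) -(lt_actV ha); apply: hl.
  have /andP[-> _] := JM (SV Sg) Jx.
  by rewrite (actV_lt ha).
- move=> x /andP[cx xr].
  have Jx : J x by have /andP[? _] := JM Sg Jc; rewrite /J/=; lra.
  rewrite !(actM ha) -(actV_lt ha); apply: hr.
  have /andP[_ ->] := JM (SV Sg) Jx.
  by rewrite (lt_actV ha) cx.
Qed.

Lemma expands_up h c : S h -> expands h c -> forall x y, c < x -> J x -> J y ->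
  exists n, forall m, (n <= m)%N -> y < a (h ^+ m)%g x.
Proof.
move=> Sh [Jc hc hl hr] x y cx Jx Jy.
pose J' := [set x | c < x < r].
have intJ' : is_interval J'.
  by move=> u v /andP[? ?] /andP[? ?] z /andP[? ?]; rewrite /J'/=; lra.
have h_up z : J' z -> z < a h z by exact: hr.
have hJ' z : J' z -> J' (a h z).
  move=> /andP[cz zr]; rewrite /J' /= -[X in X < _]hc (act_ltE ha) cz /=.
  by move: Jc => /andP[? ?]; have /andP[] : J (a h z) by apply: JM => //; rewrite /J/=; lra.
have J'X z m : J' z -> J' (a (h ^+ m)%g z).
  by move=> Jz; elim: m => [|m ih]; rewrite ?(act1 ha)// expgS (actM ha); exact: hJ'.
have J'x : J' x by move: Jx => /andP[? ?]; rewrite /J'/=; lra.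
have J'm : J' (Num.max y x).
  by move: Jx Jy J'x => /andP[? ?] /andP[? ?] /andP[? ?]; rewrite /J'/= lt_max gt_max; lra.
have [n yn] := orbit_unbounded ha intJ' hJ' h_up J'x J'm.
move: yn; rewrite gt_max => /andP[yn _].
exists n => m nm; rewrite -(subnKC nm); elim: (m - n)%N => [|k ih]; first by rewrite addn0.
rewrite addnS expgS (actM ha); apply: (lt_trans ih).
by apply: h_up; exact: J'X.
Qed.

Lemma expands_down h c : S h -> expands h c -> forall x y, x < c -> J x -> J y ->
  exists n, forall m, (n <= m)%N -> a (h ^+ m)%g x < y.
Proof.
move=> Sh [Jc hc hl hr] x y xc Jx Jy.
pose J' := [set x | l < x < c].
have intJ' : is_interval J'.
  by move=> u v /andP[? ?] /andP[? ?] z /andP[? ?]; rewrite /J'/=; lra.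
have h_up z : J' z -> z < a h^-1%g z by move=> Jz; rewrite (lt_actV ha); exact: hl.
have hV z : J' z -> J' (a h^-1%g z).
  move=> /andP[lz zc]; rewrite /J' /= (actV_lt ha) hc zc andbT.
  move: Jc => /andP[? ?].
  by have /andP[] : J (a h^-1%g z) by apply: JM => //; [exact: SV|rewrite /J/=; lra].
have hJ' z : J' z -> J' (a h z).
  move=> J'z; have := hl _ J'z; move: J'z => /andP[? ?]; rewrite /J' /=.
  move: Jc => /andP[? ?].
  have /andP[? _] : J (a h z) by apply: JM => //; rewrite /J/=; lra.
  lra.
have J'X z m : J' z -> J' (a (h ^+ m)%g z).
  by move=> Jz; elim: m => [|m ih]; rewrite ?(act1 ha)// expgS (actM ha); exact: hJ'.
have J'x : J' x by move: Jx => /andP[? ?]; rewrite /J'/=; lra.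
have J'm : J' (Num.min y x).
  by move: Jx Jy J'x => /andP[? ?] /andP[? ?] /andP[? ?]; rewrite /J'/= gt_min lt_min; lra.
have [n yn] := orbit_lower ha intJ' hV h_up J'x J'm.
rewrite expVgn invgK lt_min in yn; have {}yn := proj1 (andP yn).
exists n => m nm; rewrite -(subnKC nm); elim: (m - n)%N => [|k ih]; first by rewrite addn0.
rewrite addnS expgS (actM ha); apply: lt_trans ih.
by apply: hl; exact: J'X.
Qed.

Definition end_le g k := exists2 y, J y & forall x, y < x < r -> a g x <= a k x.

Lemma end_le_of g k y : J y -> S g -> S k ->
  (forall x, y < x < r -> x < a (g^-1 * k)%g x) -> end_le g k.
Proof.
move=> Jy Sg Sk h; exists y => // x /h; rewrite (actM ha) (lt_actV ha); exact: ltW.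
Qed.

Lemma end_le_up g k : J !=set0 -> S g -> S k -> moves_up (g^-1 * k)%g -> end_le g k.
Proof.
move=> [y Jy] Sg Sk h; apply: (end_le_of Jy) => // x /andP[yx xr]; apply: h.
by move: Jy => /andP[? _]; rewrite /J/=; lra.
Qed.

Lemma end_le_expands g k c : S g -> S k -> expands (g^-1 * k)%g c -> end_le g k.
Proof. by move=> Sg Sk [Jc _ _ h]; exact: (end_le_of Jc). Qed.

Lemma end_le_refl g : J !=set0 -> end_le g g.
Proof. by case=> y Jy; exists y. Qed.

Lemma end_le_biinvariant : J !=set0 -> biinvariant_preorder S end_le.
Proof.
move=> J0; split.
- move=> g k m [y Jy gk] [z Jz km]; exists (Num.max y z).
    by move: Jy Jz => /andP[? ?] /andP[? ?]; rewrite /J/= lt_max gt_max; lra.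
  move=> x; rewrite gt_max -andbA => /and3P[yx zx xr].
  by apply: le_trans (gk _ _) (km _ _); rewrite ?yx ?zx.
- move=> g k Sg Sk; have Sgk : S (g^-1 * k)%g by auto.
  have E : ((g^-1 * k)^-1 = k^-1 * g)%g by rewrite invgM invgK.
  case: (action_typeP Sgk).
  + by move=> e; left; rewrite -[k](mulVKg g) e mulg1; exact: end_le_refl.
  + by move=> h; left; exact: end_le_up.
  + by rewrite E => h; right; exact: end_le_up.
  + by move=> c h; left; exact: end_le_expands h.
  + by rewrite E => c h; right; exact: end_le_expands h.
- move=> c g k Sc [y Jy gk]; exists y => // x /gk.
  by rewrite !(actM ha) (act_leE ha).
- move=> c g k Sc [y Jy gk]; exists (a c^-1%g y); first by apply: JM; auto.
  move=> x /andP[yx xr]; rewrite !(actM ha); apply: gk.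
  rewrite -(actV_lt ha) yx /=.
  have : J x by have /andP[? _] := JM (SV Sc) Jy; rewrite /J /=; lra.
  by move=> /(JM Sc)/andP[].
Qed.

Lemma not_end_le g k : J !=set0 -> S g -> S k -> ~ end_le g k ->
  moves_up (k^-1 * g)%g \/ exists c, expands (k^-1 * g)%g c.
Proof.
move=> J0 Sg Sk ngk; have Sgk : S (k^-1 * g)%g by auto.
have E : ((k^-1 * g)^-1 = g^-1 * k)%g by rewrite invgM invgK.
case: (action_typeP Sgk).
- by move=> e; case: ngk; rewrite -[g](mulVKg k) e mulg1; exact: end_le_refl.
- by left.
- by rewrite E => h; case: ngk; exact: end_le_up.
- by move=> c h; right; exists c.
- by rewrite E => c h; case: ngk; exact: end_le_expands h.
Qed.

Lemma expands_not_end_le1 h c : expands h c -> ~ end_le h 1%g.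
Proof.
move=> [Jc _ _ hr] [y Jy hy].
pose x := (Num.max c y + r) / 2.
have xin : Num.max c y < x < r.
  by rewrite !midf_lt// gt_max; move: Jc Jy => /andP[_ ->] /andP[_ ->].
move: xin; rewrite gt_max -andbA => /and3P[cx yx xr].
have := hr x; have := hy x; rewrite (act1 ha) cx yx xr => /(_ isT) + /(_ isT).
lra.
Qed.

(** Otherwise every element but 1 expands or contracts, so that the order of germs at the left
    end is the opposite of the order at the right end.  If g were above all the powers of an
    expanding k at the right end, the fixed points of k^-n g would have to tend to the right end
    because of the points above the fixed point of k, and to the left end because of the points
    below.  The order is thus archimedean and the group abelian by Hoelder's theorem; but then
    g1 preserves the fixed point c of h. *)
Lemma translation_exists h c g1 : S h -> expands h c -> S g1 -> a g1 c <> c ->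
  exists2 t, S t & moves_up t.
Proof.
move=> Sh hc Sg1 g1c; apply: contrapT => notr'.
have notr t : S t -> ~ moves_up t by move=> St up; apply: notr'; exists t.
have Jc : J c by case: hc.
have J0 : J !=set0 by exists c.
have nle g k : S g -> S k -> ~ end_le g k -> exists b, expands (k^-1 * g)%g b.
  move=> Sg Sk /(not_end_le J0 Sg Sk)[|//] up.
  by case: (notr (k^-1 * g)%g); auto.
have cofinal k b : S k -> expands k b -> forall g, S g -> exists n, end_le g (k ^+ n)%g.
  move=> Sk kb g Sg; apply/not_existsP => bad.
  have Jb : J b by case: kb.
  have Jmid : J ((b + r) / 2) /\ J ((l + b) / 2).
    by move: Jb => /andP[? ?]; rewrite /J/=; lra.
  have [Jx Jy] := Jmid.
  have bx : b < (b + r) / 2 by move: Jb => /andP[? ?]; lra.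
  have yb : (l + b) / 2 < b by move: Jb => /andP[? ?]; lra.
  have [n1 h1] := expands_up Sk kb bx Jx (JM Sg Jx).
  have [n2 h2] := expands_down Sk kb yb Jy (JM Sg Jy).
  have [d wd] := nle _ _ Sg (SX (n1 + n2) Sk) (bad _).
  have := h1 (n1 + n2)%N (leq_addr _ _).
  have := h2 (n1 + n2)%N (leq_addl _ _).
  rewrite -(lt_actV ha) -(actM ha) (expands_lt wd)// => dy.
  rewrite ltNge le_eqVlt negb_or -leNgt => /andP[_].
  rewrite leNgt -(lt_actV ha) -(actM ha) (expands_lt wd)//; lra.
have hle := end_le_biinvariant J0.
have [tau [tauM tau_h tau_le]] :=
  holder_morphism R hS hle Sh (expands_not_end_le1 hc) (cofinal h c Sh hc).
have tau0 g d : S g -> expands g d -> tau g <> 0.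
  move=> Sg gd e; have [n hn] := cofinal g d Sg gd h Sh.
  by have := tau_le _ _ Sh (SX n Sg) hn; rewrite tau_h (additive_onX hS tauM)// e mulr0; lra.
pose k := (h * g1 * h^-1 * g1^-1)%g.
have Sk : S k by rewrite /k; auto 10.
have tau_k : tau k = 0 by rewrite /k !tauM ?(additive_onV hS tauM); auto; lra.
have k1 : k = 1%g.
  case: (action_typeP Sk) => //.
  - by move=> up; case: (notr k).
  - by move=> up; case: (notr k^-1%g); auto.
  - by move=> d /(tau0 _ _ Sk).
  - by move=> d /(tau0 _ _ (SV Sk)); rewrite (additive_onV hS tauM)// tau_k oppr0.
have fix1 : a h (a g1 c) = a g1 c.
  have [_ hcc _ _] := hc.
  rewrite -(actM ha) -[in RHS]hcc -(actM ha); congr (a _ c).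
  by apply: divg1_eq; rewrite invgM mulgA.
apply: g1c; have Jg := JM Sg1 Jc.
have [gc|cg|//] := ltgtP (a g1 c) c.
  have [_ _ /(_ (a g1 c)) + _] := hc; rewrite fix1 ltxx gc.
  by move: Jg => /andP[-> _] /(_ isT).
have [_ _ _ /(_ (a g1 c))] := hc; rewrite fix1 ltxx cg.
by move: Jg => /andP[_ ->] /(_ isT).
Qed.

Lemma end_leX g k n : J !=set0 -> S g -> S k -> end_le g k -> end_le (g ^+ n)%g (k ^+ n)%g.
Proof.
move=> J0 Sg Sk gk; have hle := end_le_biinvariant J0.
elim: n => [|n ih]; first exact: end_le_refl.
rewrite !expgS; apply: (bi_trans hle (k := (g * k ^+ n)%g)).
  exact: (bi_mull hle).
by apply: (bi_mulr hle); auto.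
Qed.

(** If g is above all the powers of h at the right end, the points where this holds must be
    controlled.  For a translation u they are all the points, since u moves points up near the left
    end as well while h moves them down there.  In general g is also above all the powers of the
    conjugates of h by the powers of t, whose fixed points t^k c tend to the right end; once g moves
    that fixed point up, g is above these powers on its whole right side, where they tend to r. *)
Lemma expands_cofinal h c t : S h -> expands h c -> S t -> moves_up t ->
  forall g, S g -> exists n, end_le g (h ^+ n)%g.
Proof.
move=> Sh hc St t_up.
have Jc : J c by case: hc.
have J0 : J !=set0 by exists c.
have hle := end_le_biinvariant J0.
have contra_up k b g d : S k -> expands k b -> S g -> J d ->
    ~ (forall n x, d < x < r -> b < x -> a (k ^+ n)%g x < a g x).
  move=> Sk kb Sg Jd lt.
  have Jb : J b by case: kb.
  pose x := (Num.max d b + r) / 2.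
  have : Num.max d b < x < r.
    by rewrite !midf_lt// gt_max; move: Jb Jd => /andP[_ ->] /andP[_ ->].
  rewrite gt_max -andbA => /and3P[dx bx xr].
  have Jx : J x by move: Jb => /andP[? ?]; rewrite /J/=; lra.
  have [n hn] := expands_up Sk kb bx Jx (JM Sg Jx).
  have := hn n (leqnn n); have := lt n x; rewrite dx xr => /(_ isT bx); lra.
have hX_le n x : l < x < c -> a (h ^+ n)%g x <= x.
  have [_ _ hl _] := hc; move=> /[dup] xin /hl hx.
  elim: n => [|n ih]; first by rewrite (act1 ha).
  rewrite expgSr (actM ha); apply: le_trans ih.
  by rewrite (act_leE ha) ltW.
have cof_up u : S u -> moves_up u -> exists n, end_le u (h ^+ n)%g.
  move=> Su u_up; apply/not_existsP => bad.
  apply: (contra_up h c u c) => // n x xin cx.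
  have [up|[b wb]] := not_end_le J0 Su (SX n Sh) (bad n).
    rewrite -(lt_actV ha) -(actM ha); apply: up.
    by move: Jc => /andP[? ?]; rewrite /J/=; lra.
  have Jb : J b by case: wb.
  pose y := (l + Num.min c b) / 2.
  have : l < y < Num.min c b.
    by rewrite !midf_lt// lt_min; move: Jc Jb => /andP[-> _] /andP[-> _].
  rewrite lt_min => /and3P[ly yc yb].
  have Jy : J y by move: Jc => /andP[? ?]; rewrite /J/=; lra.
  have : y < a ((h ^+ n)^-1 * u)%g y.
    rewrite (actM ha) (lt_actV ha); apply: le_lt_trans (u_up _ Jy).
    by apply: hX_le; rewrite ly.
  by rewrite (expands_lt wb)//; lra.
move=> g Sg; apply/not_existsP => bad.
have [y0 Jy0 gy0] : exists2 y, J y & forall x, y < x < r -> x < a g x.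
  have := not_end_le J0 Sg S1 (bad 0%N); rewrite invg1 mul1g => -[up|[b [Jb _ _ gr]]].
    exists c => // x /andP[cx xr]; apply: up.
    by move: Jc => /andP[? ?]; rewrite /J/=; lra.
  by exists b.
have [k y0k] := orbit_unbounded ha intJ (fun z => JM St) t_up Jc Jy0.
pose u := (t ^+ k)%g; have Su : S u := SX k St.
pose h' := (u * h * u^-1)%g; pose c' := a u c.
have Sh' : S h' by rewrite /h'; auto.
have hc' : expands h' c' by exact: expands_conj.
have Jc' : J c' by exact: JM.
have u_ge x : J x -> x <= a u x.
  move=> Jx; rewrite /u; elim: (k) => [|m ih]; first by rewrite (act1 ha).
  rewrite expgS (actM ha); apply: (le_trans ih); apply: ltW; apply: t_up.
  by apply: JM => //; exact: SX.
have [m um] : exists m, end_le u (h ^+ m)%g.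
  have [m tm] := cof_up t St t_up; exists (m * k)%N.
  by rewrite expgnA; apply: end_leX => //; exact: SX.
have h'm : end_le h' (h ^+ m.+1)%g.
  apply: (bi_trans hle (k := (h ^+ m.+1 * u^-1)%g)).
    rewrite /h' expgSr; do 2 ![apply: (bi_mulr hle); auto].
  rewrite -[X in end_le _ X]mulg1; apply: (bi_mull hle); first exact: SX.
  exists c => // x /andP[cx xr]; rewrite (act1 ha) leNgt (lt_actV ha) -leNgt.
  by apply: u_ge; move: Jc => /andP[? ?]; rewrite /J/=; lra.
apply: (contra_up h' c' g c') => // n x xin cx.
have ngh' : ~ end_le g (h' ^+ n)%g.
  move=> gh'; apply: (bad (m.+1 * n)%N); apply: (bi_trans hle gh').
  by rewrite expgnA; apply: end_leX => //; exact: SX.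
have c'w : c' < a ((h' ^+ n)^-1 * g)%g c'.
  rewrite (actM ha) (lt_actV ha) (actX_fix ha); last by case: hc'.
  by apply: gy0; rewrite y0k; move: Jc' => /andP[].
rewrite -(lt_actV ha) -(actM ha).
have [up|[b wb]] := not_end_le J0 Sg (SX n Sh') ngh'.
  by apply: up; move: Jc' => /andP[? ?]; rewrite /J/=; lra.
rewrite (expands_lt wb) in c'w => //.
case: wb => Jb _ _ wr; apply: wr; lra.
Qed.

(** Without expanding elements the action is free.  Otherwise an expanding element h is cofinal
    for the order of germs at r; let phi be the translation number relative to h, which plays
    the part of the logarithm of the multiplier.  It does not vanish on expanding elements,
    so its kernel N acts freely, and it contains the commutators, so N is not trivial.
    The semi-conjugacy theta of N to translations is unique up to affine maps, hence the
    whole group, which normalizes N, acts along theta by affine maps. *)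
Theorem solodov g0 x0 : S g0 -> J x0 -> a g0 x0 <> x0 ->
  (forall c, J c -> exists2 g, S g & a g c <> c) ->
  exists theta : R -> R,
    [/\ {in J &, {homo theta : x y / x <= y}},
        forall y, exists2 x, J x & theta x = y &
        forall g, S g -> exists al be, 0 < al /\ forall x, J x -> theta (a g x) = al * theta x + be].
Proof.
move=> Sg0 Jx0 g0x0 nofix.
have J0 : J !=set0 by exists x0.
have [[h [c [Sh hc]]]|noexp] := pselect (exists h c, S h /\ expands h c); last first.
  have free : acts_freely a S J.
    split=> // g Sg; case: (action_typeP Sg) => h.
    - by constructor 1.
    - by constructor 2.
    - by constructor 3 => x Jx; rewrite -(lt_actV ha); exact: h.
    - by move=> hh; case: noexp; exists g, h.
    - by move=> hh; case: noexp; exists g^-1%g, h; auto.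
  have [t St tx0] : exists2 t, S t & x0 < a t x0.
    have [lt|gt|e] := ltgtP x0 (a g0 x0); [by exists g0| |by case: g0x0].
    by exists g0^-1%g; [exact: SV|rewrite (lt_actV ha)].
  have [tau htau] := free_order_morphism ha hS free intJ St Jx0 tx0.
  have [th [nd surj eqv]] := free_semiconjugacy ha hS free htau intJ Jx0 St tx0.
  exists th; split=> // g Sg; exists 1, (tau g); split=> // x Jx.
  by rewrite mul1r eqv.
have Jc : J c by case: hc.
have [g1 Sg1 g1c] := nofix c Jc.
have [t St t_up] := translation_exists Sh hc Sg1 g1c.
have hle := end_le_biinvariant J0.
have [phi [phiM phi_h phi_le]] := holder_morphism R hS hle Sh (expands_not_end_le1 hc)
  (expands_cofinal Sh hc St t_up).
have phi1 := additive_on1 hS phiM.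
have phiV := additive_onV hS phiM.
have phiX := additive_onX hS phiM.
have phi_exp g d : S g -> expands g d -> phi g <> 0.
  move=> Sg gd e; have [n hn] := expands_cofinal Sg gd St t_up Sh.
  by have := phi_le _ _ Sh (SX n Sg) hn; rewrite phi_h phiX// e mulr0; lra.
pose N := [set g | S g /\ phi g = 0].
have hN : is_subgroup N.
  split; first by split.
  - by move=> g k [Sg g0'] [Sk k0]; split; [exact: SM|rewrite phiM// g0' k0 addr0].
  - by move=> g [Sg g0']; split; [exact: SV|rewrite phiV// g0' oppr0].
have NJ g k : S g -> N k -> N (g * k * g^-1)%g.
  by move=> Sg [Sk k0]; split; [auto|rewrite !phiM ?phiV ?k0; auto; lra].
have freeN : acts_freely a N J.
  split=> [g x [Sg _]|g [Sg g0']]; first exact: JM.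
  case: (action_typeP Sg) => h'.
  - by constructor 1.
  - by constructor 2.
  - by constructor 3 => x Jx; rewrite -(lt_actV ha); exact: h'.
  - by move/(phi_exp _ _ Sg).
  - by move/(phi_exp _ _ (SV Sg)); rewrite phiV// g0' oppr0.
(* the commutator of h and t moves the fixed point c of h, because h moves the points on
   the left of c down *)
have [n0 Nn0 n0c] : exists2 n0, N n0 & c < a n0 c.
  exists (h * (t * h^-1 * t^-1))%g.
    by split; [auto 10|rewrite !phiM ?phiV; auto 10; lra].
  have [_ hcc hl _] := hc.
  rewrite !(actM ha) -[X in X < _]hcc (act_ltE ha) -(actV_lt ha) (lt_actV ha).
  apply: hl; have /andP[-> _] := JM (SV St) Jc.
  by rewrite (actV_lt ha); exact: t_up.
have [tau htau] := free_order_morphism ha hN freeN intJ Nn0 Jc n0c.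
have tau_n0 : 0 < tau n0 by rewrite -(tau_pos ha hN freeN htau Nn0 Jc).
(* conjugation by h contracts N towards c, so tau (N) has no least positive value *)
have small : forall e, 0 < e -> exists2 g, N g & 0 < tau g < e.
  have [//|[k [Nk k0 kmin]]] := order_morphism_dichotomy ha hN freeN htau Jc Nn0 n0c.
  exfalso; have := k0; rewrite -(tau_pos ha hN freeN htau Nk Jc) => ck.
  have [_ hcc _ hr] := hc.
  have Nk' : N (h^-1 * k * h^-1^-1)%g by apply: NJ; auto.
  have := kmin _ Nk'; rewrite -(tau_pos ha hN freeN htau Nk' Jc).
  rewrite leNgt -(tau_lt ha hN freeN htau Nk' Nk Jc) invgK !(actM ha) hcc.
  rewrite (lt_actV ha) hcc ck => /(_ isT); rewrite (actV_lt ha) hr// ck.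
  by have /andP[_ ->] := JM Nk.1 Jc.
have [th [nd surj eqv]] := dense_semiconjugacy ha hN freeN htau intJ Jc small.
exists th; split=> // g Sg.
pose conj k := (g * k * g^-1)%g.
have conjM k k' : conj (k * k')%g = (conj k * conj k')%g.
  by rewrite /conj !mulgA mulgVK.
have hsigma : order_morphism a N J (tau \o conj).
  split=> [k k' Nk Nk'|k x Nk Jx kx] /=; first by rewrite conjM htau.1//; exact: NJ.
  rewrite -(tau_pos ha hN freeN htau (NJ g k Sg Nk) (JM Sg Jx)).
  by rewrite /conj !(actM ha) (actVK ha) (act_ltE ha).
pose lam := tau (conj n0) / tau n0.
have sigma_lam k : N k -> tau (conj k) = lam * tau k.
  move=> Nk; have := order_morphism_proportional ha hN freeN J0 hsigma htau Nk Nn0 tau_n0.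
  by rewrite /= /lam => e; rewrite mulrAC -e mulfK// gt_eqF.
have lam_gt0 : 0 < lam.
  rewrite divr_gt0// -(tau_pos ha hN freeN htau (NJ g n0 Sg Nn0) (JM Sg Jc)).
  by rewrite /conj !(actM ha) (actVK ha) (act_ltE ha).
pose th' x := th (a g x) / lam.
have nd' : {in J &, {homo th' : x y / x <= y}}.
  move=> x y; rewrite !inE => Jx Jy xy; rewrite /th' ler_pM2r ?invr_gt0//.
  by apply: nd; rewrite ?inE ?(act_leE ha)//; exact: JM.
have eqv' k x : N k -> J x -> th' (a k x) = th' x + tau k.
  move=> Nk Jx; rewrite /th' -(actM ha) (_ : (g * k)%g = (conj k * g)%g); last first.
    by rewrite /conj mulgVK.
  rewrite (actM ha) eqv; [|exact: NJ|exact: JM].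
  by rewrite sigma_lam// mulrDl [lam * _]mulrC mulfK// gt_eqF.
exists lam, (th (a g c) - lam * th c); split=> // x Jx.
have := dense_semiconjugacy_unique hN freeN htau small nd nd' eqv eqv' Jc Jx.
rewrite /th' -mulrBl => /(congr1 ( *%R^~ lam)) /=; rewrite divfK ?gt_eqF// mulrBl.
rewrite [th x * _]mulrC [th c * _]mulrC; lra.
Qed.
End Solodov.

(** * Lifts of circle maps *)

Section Lifts.
Variable R : realType.
Implicit Types (F h : R -> R) (x y : R).

Definition degree_one F := forall x, F (x + 1) = F x + 1.

Lemma degree_oneZ F : degree_one F -> forall x (n : int), F (x + n%:~R) = F x + n%:~R.
Proof.
move=> F1 x; elim/int_ind => [|n ih|n ih]; first by rewrite !addr0.
  by rewrite -addn1 PoszD intrD !addrA F1 ih.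
rewrite -addn1 PoszD opprD intrD; apply: (addIr 1).
by rewrite -F1 -!addrA addNr !addr0 ih.
Qed.

(** Monotone maps enter by their being onto rather than by their continuity. *)
Lemma nondecreasing_surj_continuous h :
  {homo h : x y / x <= y} -> (forall y, exists x, h x = y) -> continuous h.
Proof.
move=> h_nd h_surj x; apply/cvgrPdist_lt => e e0.
have [u hu] := h_surj (h x - e / 2); have [v hv] := h_surj (h x + e / 2).
have ux : u < x by rewrite ltNge; apply/negP => /h_nd; rewrite hu; lra.
have xv : x < v by rewrite ltNge; apply/negP => /h_nd; rewrite hv; lra.
have xuv : x \in `]u, v[ by rewrite in_itv /= ux.
near=> y.
have : y \in `]u, v[ by near: y; exact: near_in_itvoo.
rewrite in_itv /= => /andP[uy yv].
have := h_nd _ _ (ltW uy); have := h_nd _ _ (ltW yv); rewrite hu hv.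
by rewrite ltr_norml => ? ?; lra.
Unshelve. all: by end_near.
Qed.

Lemma homeo_Z_of F : {homo F : x y / x < y} -> (forall y, exists x, F x = y) ->
  degree_one F -> exists P : homeo_Z R, homeo_Z_fun P = F.
Proof.
move=> F_inc F_surj F1.
have Fle : {mono F : x y / x <= y} by exact: le_mono.
pose K y := sval (cid (F_surj y)).
have FK : cancel K F by move=> y; rewrite /K; case: cid.
have KF : cancel F K by move=> x; apply: (inc_inj Fle); rewrite FK.
have hF : is_homeo F.
  apply/asboolP; split; first by apply: nondecreasing_surj_continuous => // x y; rewrite Fle.
  exists K; split=> //; apply: nondecreasing_surj_continuous => [x y xy|x].
    by rewrite -Fle !FK.
  by exists (F x).
have FZ : Homeo hF \in @Z_equivariant R by apply/asboolP; exact: degree_oneZ.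
by exists (exist _ (Homeo hF) FZ).
Qed.

Lemma homeo_ZD (P : homeo_Z R) x (n : int) : P (x + n%:~R) = P x + n%:~R.
Proof. by have /asboolP := valP P; apply. Qed.

Lemma homeo_Z_degree_one (P : homeo_Z R) : degree_one P.
Proof. by move=> x; exact: (homeo_ZD P x 1). Qed.

Lemma homeo_ZM (P Q : homeo_Z R) x : homeo_Z_fun (P * Q)%g x = P (Q x).
Proof. by []. Qed.

Lemma homeo_Z_inj (P Q : homeo_Z R) : (forall x, P x = Q x) -> P = Q.
Proof. by move=> PQ; apply/val_inj/val_inj/funext. Qed.

Fact translation_subproof (c : R) : exists P : homeo_Z R, homeo_Z_fun P = +%R^~ c.
Proof.
apply: homeo_Z_of => [x y|y|x]; first by rewrite ltrD2r.
  by exists (y - c); rewrite subrK.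
by rewrite addrAC.
Qed.

Definition translation c := sval (cid (translation_subproof c)).

Lemma translationE c x : translation c x = x + c.
Proof. by rewrite /translation; case: cid => P /= ->. Qed.

Lemma to_circle_surj (p : circle R) : exists x, to_circle x = p.
Proof. by exists (repr p); exact: reprK. Qed.

Lemma to_circleP x y : to_circle x = to_circle y <-> exists n : int, x = y + n%:~R.
Proof.
rewrite to_circle_eq; split=> [/intrP[n e]|[n ->]]; first by exists n; rewrite -e addrC subrK.
by rewrite addrC addKr intr_int.
Qed.

Lemma to_circleDz x (n : int) : to_circle (x + n%:~R) = to_circle x.
Proof. by apply/to_circleP; exists n. Qed.

Lemma to_circle_continuous : continuous (@to_circle R).
Proof. exact: pi_continuous. Qed.

Lemma lifts_inj F (f f' : circle R -> circle R) : lifts F f -> lifts F f' -> f = f'.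
Proof.
by move=> Ff Ff'; apply/funext => p; have [x <-] := to_circle_surj p; rewrite Ff Ff'.
Qed.

Lemma homeo_plus_inj (f g : homeo_plus R) : homeo_plus_fun f = homeo_plus_fun g -> f = g.
Proof. by move=> e; apply/val_inj/val_inj. Qed.

Lemma homeo_plusM (f g : homeo_plus R) p : homeo_plus_fun (f * g)%g p = f (g p).
Proof. by []. Qed.

Lemma liftsM F K (f g : circle R -> circle R) : lifts F f -> lifts K g -> lifts (F \o K) (f \o g).
Proof. by move=> Ff Kg x /=; rewrite Kg Ff. Qed.

Lemma descends_continuous F : continuous F -> degree_one F ->
  exists2 f : circle R -> circle R, continuous f & lifts F f.
Proof.
move=> Fc F1; pose f : circle R -> circle R := (@to_circle R \o F) \o repr.
have compat x y : to_circle x = to_circle y -> to_circle (F x) = to_circle (F y).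
  by move=> /to_circleP[n ->]; rewrite degree_oneZ// to_circleDz.
exists f; last by move=> x; apply: compat; exact: reprK.
apply: repr_comp_continuous => [x|x y /eqP xy].
  by apply: continuous_comp; [exact: Fc|exact: to_circle_continuous].
by apply/eqP; exact: compat.
Qed.

Lemma homeo_Z_continuous (P : homeo_Z R) : continuous P.
Proof. exact: homeo_continuous. Qed.

Lemma homeo_plus_continuous (f : homeo_plus R) : continuous (homeo_plus_fun f).
Proof. exact: homeo_continuous. Qed.

Lemma descends (P : homeo_Z R) : {homo P : x y / x < y} ->
  exists f : homeo_plus R, lifts P f.
Proof.
move=> Pinc.
have [f fc Pf] := descends_continuous (@homeo_Z_continuous P) (@homeo_Z_degree_one P).
have [g gc Pg] := descends_continuous (@homeo_Z_continuous P^-1%g) (@homeo_Z_degree_one P^-1%g).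
have hf : is_homeo f.
  apply/asboolP; split=> //; exists g; split=> // p.
    by have [x <-] := to_circle_surj p; rewrite Pf Pg -homeo_ZM mulVg.
  by have [x <-] := to_circle_surj p; rewrite Pg Pf -homeo_ZM mulgV.
have fo : Homeo hf \in @orientation_preserving R by apply/asboolP; exists (val P).
by exists (exist _ (Homeo hf) fo).
Qed.

(** An increasing lift F of a bijection of the circle has degree one: it increases by an integer
    over a period, and an integer above 1 would make the circle map take a value twice. *)
Lemma lift_exists (f : homeo_plus R) :
  exists2 P : homeo_Z R, {homo P : x y / x < y} & lifts P f.
Proof.
have /asboolP[F [Finc Ff]] := valP f.
have Fle : {mono F : x y / x <= y} by exact: le_mono.
have f_inj : injective (homeo_plus_fun f) by exact: can_inj (homeoK (val f)).
have F_surj y : exists x, F x = y by exists ((F^-1)%g y); exact: homeoVK.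
have F1 : degree_one F.
  move=> x; have [n e] : exists n : int, F (x + 1) = F x + n%:~R.
    by apply/to_circleP; rewrite -!Ff (to_circleDz x 1).
  have n_ge1 : 1 <= n.
    rewrite leNgt; apply/negP => n1; have : F x < F (x + 1) by apply: Finc; rewrite ltrDl.
    rewrite e ltrDl ltr0z; lia.
  have [y yE] := F_surj (F x + 1).
  have [m ym] : exists m : int, y = x + m%:~R.
    apply/to_circleP/f_inj; rewrite -[LHS]/(val f _) -[RHS]/(val f _) !Ff yE; exact: (to_circleDz _ 1).
  have : F x < F y by rewrite yE ltrDl.
  rewrite (leW_mono Fle) ym ltrDl ltr0z => m0.
  have : F y <= F (x + 1) by rewrite yE e lerD2l ler1z.
  rewrite Fle ym lerD2l lerz1 => m1.
  by rewrite -yE ym (_ : m = 1)//; lia.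
have [P PE] := homeo_Z_of Finc F_surj F1.
by exists P; rewrite PE.
Qed.

End Lifts.

(** * Fixed points of projective maps *)

Section ProjectiveLifts.
Variable R : realType.
Implicit Types (x y : R).

Definition projective_lift (P : R -> R) := exists A : 'M[R]_2, \det A = 1 /\
  forall x, exists k, A *m direction x = k *: direction (P x).

Lemma directionD1 x : direction (x + 1) = - direction x.
Proof.
apply/colP => i; rewrite !mxE mulrDr mulr1 cosDpi sinDpi.
by case: ifP.
Qed.

Lemma directionDz x (n : int) : exists s, direction (x + n%:~R) = s *: direction x.
Proof.
elim/int_ind: n => [|n [s IH]|n [s IH]].
- by exists 1; rewrite addr0 scale1r.
- exists (- s); rewrite scaleNr -IH -directionD1 -addrA.
  by congr (direction (_ + _)); rewrite -[in LHS]addn1 PoszD intrD.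
- exists (- s); rewrite scaleNr -IH; apply/eqP; rewrite eq_sym eqr_oppLR -directionD1 -addrA.
  by apply/eqP; congr (direction (_ + _)); rewrite -[in RHS]addn1 PoszD opprD intrD subrK.
Qed.

Lemma proj_lineE x : proj_line (to_circle x) = [set v | exists c, v = c *: direction x].
Proof.
apply/seteqP; split=> [v [y [c [/to_circleP[n ->] ->]]]|v [c ->]].
  by have [s ->] := directionDz x n; exists (c * s); rewrite scalerA.
by exists x, c.
Qed.

Lemma direction_neq0 x : direction x != 0.
Proof.
apply/eqP => /colP e; have := e 0; have := e 1; rewrite !mxE /= => s0 c0.
by have := cos2Dsin2 (pi * x); rewrite c0 s0 expr0n addr0 => /eqP; rewrite eq_sym oner_eq0.
Qed.

Lemma projective_lift_of (f : homeo_plus R) (P : R -> R) :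
  f \in @is_projective R -> lifts P f -> projective_lift P.
Proof.
move=> /asboolP[A [detA fA]] Pf; exists A; split=> // x.
have : [set A *m v | v in proj_line (to_circle x)] (A *m direction x).
  by exists (direction x) => //; exists x, 1; rewrite scale1r.
by rewrite -fA Pf proj_lineE.
Qed.

Lemma projective_of_lift (f : homeo_plus R) (P : R -> R) :
  projective_lift P -> lifts P f -> f \in @is_projective R.
Proof.
move=> [A [detA PA]] Pf; apply/asboolP; exists A; split=> // p.
have [x <-] := to_circle_surj p; rewrite Pf !proj_lineE.
have [k kE] := PA x.
have uA : A \in unitmx by rewrite unitmxE detA unitr1.
have k0 : k != 0.
  apply/eqP => k0; have := direction_neq0 x.
  by rewrite -(mulKmx uA (direction x)) kE k0 scale0r mulmx0 eqxx.
apply/seteqP; split=> [_ [c ->]|_ [_ [c ->] <-]].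
  exists ((c / k) *: direction x); first by exists (c / k).
  by rewrite -scalemxAr kE scalerA divfK.
by exists (c * k); rewrite -scalemxAr kE scalerA.
Qed.

Lemma projective_liftM P Q : projective_lift P -> projective_lift Q ->
  projective_lift (P \o Q).
Proof.
move=> [A [dA PA]] [B [dB QB]]; exists (A *m B); split; first by rewrite det_mulmx dA dB mulr1.
move=> x; have [k kE] := QB x; have [m mE] := PA (Q x).
by exists (k * m); rewrite -mulmxA kE -scalemxAr mE scalerA.
Qed.

Lemma det_mx2 (A : 'M[R]_2) : \det A = A 0 0 * A 1 1 - A 0 1 * A 1 0.
Proof.
rewrite (expand_det_row _ 0) !big_ord_recl big_ord0 /cofactor !det_mx11 !mxE /=.
have e1 : lift ord0 ord0 = 1 :> 'I_2 by exact/val_inj.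
have e0 : lift (lift ord0 ord0) 0 = 0 :> 'I_2 by exact/val_inj.
rewrite e0 e1 /bump /= addn0 expr0 addn1 expr1 addr0 mul1r mulN1r mulrN.
by congr (_ * A _ _ - _); exact/val_inj.
Qed.

Lemma mul_directionP (A : 'M[R]_2) x x' k : A *m direction x = k *: direction x' <->
  A 0 0 * cos (pi * x) + A 0 1 * sin (pi * x) = k * cos (pi * x') /\
  A 1 0 * cos (pi * x) + A 1 1 * sin (pi * x) = k * sin (pi * x').
Proof.
have e i : (A *m direction x) i 0 = A i 0 * cos (pi * x) + A i 1 * sin (pi * x).
  rewrite !mxE !big_ord_recl big_ord0 !mxE /= addr0.
  by congr (_ + A _ _ * _); exact/val_inj.
split=> [/colP h|[h0 h1]]; first by rewrite -!e !h !mxE.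
apply/colP => i; rewrite e !mxE.
case: i => -[|[|//]] i2.
  by rewrite (_ : Ordinal i2 = 0)//; exact/val_inj.
by rewrite (_ : Ordinal i2 = 1)//; exact/val_inj.
Qed.

(** The sine of the angle between two lines is the determinant of their unit
    vectors, so that a matrix of determinant 1 preserves it up to scaling. *)
Lemma det_direction (A : 'M[R]_2) x y x' y' k m : \det A = 1 ->
  A *m direction x = k *: direction x' -> A *m direction y = m *: direction y' ->
  k * m * sin (pi * (y' - x')) = sin (pi * (y - x)).
Proof.
rewrite det_mx2 => detA /mul_directionP[kx0 kx1] /mul_directionP[my0 my1].
rewrite !mulrBr !sinB -[RHS]mul1r -detA.
transitivity ((k * cos (pi * x')) * (m * sin (pi * y')) -
              (k * sin (pi * x')) * (m * cos (pi * y'))); first by ring.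
by rewrite -kx0 -kx1 -my0 -my1; ring.
Qed.

Lemma sin_pi_gt0 x : -1 < x < 1 -> (0 < sin (pi * x)) = (0 < x).
Proof.
move=> /andP[x1 x2]; have pi0 := @pi_gt0 R.
have pos y : 0 < y < 1 -> 0 < sin (pi * y).
  move=> /andP[y0 y1]; apply: sin_gt0_pi; rewrite mulr_gt0//=.
  by rewrite -[X in _ < X]mulr1 ltr_pM2l.
have [x0|x0|<-] := ltgtP 0 x; first by rewrite pos// x0.
  have : 0 < sin (pi * - x) by apply: pos; lra.
  by rewrite mulrN sinN; lra.
by rewrite mulr0 sin0 ltxx.
Qed.

Definition hyperbolic_between (P : R -> R) (x0 x1 : R) :=
  [\/ forall x, x0 < x < x0 + 1 -> P x = x,
    (forall x, x0 < x < x1 -> x < P x) /\ (forall x, x1 < x < x0 + 1 -> P x < x) |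
    (forall x, x0 < x < x1 -> P x < x) /\ (forall x, x1 < x < x0 + 1 -> x < P x)].

(** A matrix of eigenvalues l0 and 1 / l0 in the eigenlines x0 and x1 multiplies the quotient
    sin (pi (x - x0)) / sin (pi (x1 - x)), which is increasing between the poles, by l0^-2.
    The sense in which x moves is therefore given by the sign of 1 - l0^2 on one arc and by
    the opposite sign on the other. *)
Lemma projective_lift_hyperbolic_between (P : R -> R) x0 x1 :
  {homo P : x y / x < y} -> degree_one P -> projective_lift P ->
  x0 < x1 < x0 + 1 -> P x0 = x0 -> P x1 = x1 -> hyperbolic_between P x0 x1.
Proof.
move=> Pinc P1 [A [detA PA]] /andP[x01 x10] P0 Px1.
have [l0 hl0] := PA x0; have [l1 hl1] := PA x1; rewrite P0 in hl0; rewrite Px1 in hl1.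
have d10 : 0 < sin (pi * (x1 - x0)) by rewrite sin_pi_gt0; lra.
have l01 : l0 * l1 = 1.
  apply: (mulIf (lt0r_neq0 d10)); rewrite mul1r.
  exact: det_direction hl0 hl1.
have l0_neq0 : l0 != 0 by apply/eqP => e; move: l01; rewrite e mul0r => /eqP; rewrite eq_sym oner_eq0.
have ratio x : l0 ^+ 2 * sin (pi * (P x - x0)) * sin (pi * (x1 - x)) =
    sin (pi * (x - x0)) * sin (pi * (x1 - P x)).
  have [k hk] := PA x.
  rewrite -(det_direction detA hl0 hk) -(det_direction detA hk hl1).
  rewrite -[RHS]mul1r -l01 expr2.
  transitivity (l0 * l0 * sin (pi * (P x - x0)) * (k * l1 * sin (pi * (x1 - P x)))); ring.
(* the difference of two such quotients, by the addition formula *)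
have key x : sin (pi * (P x - x)) * sin (pi * (x1 - x0)) =
    (1 - l0 ^+ 2) * sin (pi * (P x - x0)) * sin (pi * (x1 - x)).
  transitivity (sin (pi * (P x - x0)) * sin (pi * (x1 - x)) -
      sin (pi * (x - x0)) * sin (pi * (x1 - P x))).
    by rewrite !mulrBr !sinB; ring.
  by rewrite -ratio; ring.
have in0 x : x0 < x < x0 + 1 -> x0 < P x < x0 + 1.
  by move=> /andP[/Pinc + /Pinc]; rewrite P1 P0 => -> ->.
have gt_sgn x : x0 < x < x0 + 1 -> x != x1 ->
    (x < P x) = (0 < (1 - l0 ^+ 2) * (x1 - x)) /\ (P x < x) = ((1 - l0 ^+ 2) * (x1 - x) < 0).
  move=> xin xx1; have Pin := in0 _ xin.
  have sP : 0 < sin (pi * (P x - x0)) by rewrite sin_pi_gt0; lra.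
  have sgP : (0 < sin (pi * (P x - x))) = (x < P x) by rewrite sin_pi_gt0; lra.
  have sgN : (sin (pi * (P x - x)) < 0) = (P x < x).
    rewrite -oppr_gt0 -sinN -mulrN opprB sin_pi_gt0; lra.
  have sgx : (0 < sin (pi * (x1 - x))) = (0 < x1 - x) by rewrite sin_pi_gt0; lra.
  have sgxN : (sin (pi * (x1 - x)) < 0) = (x1 - x < 0).
    rewrite -oppr_gt0 -sinN -mulrN opprB sin_pi_gt0; lra.
  rewrite -sgP -sgN -(pmulr_lgt0 _ d10) -(pmulr_llt0 _ d10) key.
  rewrite mulrAC (pmulr_lgt0 _ sP) (pmulr_llt0 _ sP).
  have [lt|gt|e] := ltgtP x x1; last by rewrite e eqxx in xx1.
    have a1 : 0 < x1 - x by lra.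
    rewrite a1 in sgx; rewrite (pmulr_lgt0 _ a1) (pmulr_llt0 _ a1).
    by rewrite (pmulr_lgt0 _ sgx) (pmulr_llt0 _ sgx).
  have a1 : x1 - x < 0 by lra.
  rewrite a1 in sgxN; rewrite (nmulr_lgt0 _ a1) (nmulr_llt0 _ a1).
  by rewrite (nmulr_lgt0 _ sgxN) (nmulr_llt0 _ sgxN).
have [lt|gt|e] := ltgtP (l0 ^+ 2) 1.
- have a : 0 < 1 - l0 ^+ 2 by lra.
  constructor 2; split=> x xin.
    have xn : x != x1 by rewrite lt_eqF//; lra.
    have [-> _] := gt_sgn x ltac:(lra) xn.
    rewrite pmulr_rgt0//; lra.
  have xn : x != x1 by rewrite gt_eqF//; lra.
    have [_ ->] := gt_sgn x ltac:(lra) xn.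
  rewrite pmulr_rlt0//; lra.
- have a : 1 - l0 ^+ 2 < 0 by lra.
  constructor 3; split=> x xin.
    have xn : x != x1 by rewrite lt_eqF//; lra.
    have [_ ->] := gt_sgn x ltac:(lra) xn.
    rewrite nmulr_rlt0//; lra.
  have xn : x != x1 by rewrite gt_eqF//; lra.
    have [-> _] := gt_sgn x ltac:(lra) xn.
  rewrite nmulr_rgt0//; lra.
- constructor 1 => x xin; have [->|xx1] := eqVneq x x1; first exact: Px1.
  have [a b] := gt_sgn _ xin xx1; move: a b; rewrite e subrr !mul0r ltxx.
  by case: ltgtP.
Qed.

Lemma hyperbolic_between_conj (P Q : homeo_Z R) x0 x1 :
  {homo Q : x y / x < y} ->
  hyperbolic_between (homeo_Z_fun (Q^-1 * P * Q)%g) (homeo_Z_fun Q^-1%g x0) (homeo_Z_fun Q^-1%g x1) ->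
  hyperbolic_between P x0 x1.
Proof.
move=> Qinc.
have QVK x : Q (homeo_Z_fun Q^-1%g x) = x by rewrite -homeo_ZM mulgV.
have Qlt : {mono Q : x y / x < y} by apply: leW_mono; exact: le_mono.
have QVlt x y : (homeo_Z_fun Q^-1%g x < homeo_Z_fun Q^-1%g y) = (x < y).
  by rewrite -Qlt !QVK.
have QV1 x : homeo_Z_fun Q^-1%g x + 1 = homeo_Z_fun Q^-1%g (x + 1).
  by rewrite homeo_Z_degree_one.
have conjE x : homeo_Z_fun (Q^-1 * P * Q)%g (homeo_Z_fun Q^-1%g x) = homeo_Z_fun Q^-1%g (P x).
  by rewrite !homeo_ZM QVK.
move=> [h|[h1 h2]|[h1 h2]].
- constructor 1 => x xin; have := h (homeo_Z_fun Q^-1%g x).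
  by rewrite conjE QV1 !QVlt xin => /(_ isT) /(congr1 Q); rewrite !QVK.
- by constructor 2; split=> x xin; [have := h1 (homeo_Z_fun Q^-1%g x)|
    have := h2 (homeo_Z_fun Q^-1%g x)]; rewrite conjE ?QV1 !QVlt xin => /(_ isT).
- by constructor 3; split=> x xin; [have := h1 (homeo_Z_fun Q^-1%g x)|
    have := h2 (homeo_Z_fun Q^-1%g x)]; rewrite conjE ?QV1 !QVlt xin => /(_ isT).
Qed.

Lemma homeo_ZV_inc (Q : homeo_Z R) : {homo Q : x y / x < y} ->
  {homo homeo_Z_fun Q^-1%g : x y / x < y}.
Proof.
move=> Qinc x y xy; have Qlt : {mono Q : x y / x < y} by apply: leW_mono; exact: le_mono.
by rewrite -Qlt -!homeo_ZM mulgV.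
Qed.

Lemma liftsV (Q : homeo_Z R) (f : homeo_plus R) : lifts Q f ->
  lifts (homeo_Z_fun Q^-1%g) (homeo_plus_fun f^-1%g).
Proof.
move=> Qf x; have fK p : homeo_plus_fun f^-1%g (f p) = p by rewrite -homeo_plusM mulVg.
by rewrite -[in RHS](fK (to_circle _)) Qf -homeo_ZM mulgV.
Qed.

(** The property only concerns the order, so it is invariant under conjugation. *)
Lemma mobius_hyperbolic_between (f : homeo_plus R) (P : homeo_Z R) x0 x1 :
  (exists k : homeo_plus R, (f ^ k)%g \in @is_projective R) ->
  {homo P : x y / x < y} -> lifts P f ->
  x0 < x1 < x0 + 1 -> P x0 = x0 -> P x1 = x1 -> hyperbolic_between P x0 x1.
Proof.
move=> [k fk] Pinc Pf /andP[x01 x10] P0 P1.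
have [Q Qinc Qk] := lift_exists k.
have QVinc := homeo_ZV_inc Qinc.
have QVK x : Q (homeo_Z_fun Q^-1%g x) = x by rewrite -homeo_ZM mulgV.
apply: (hyperbolic_between_conj Qinc).
have QP : lifts (homeo_Z_fun (Q^-1 * P * Q)%g) (homeo_plus_fun (f ^ k)%g).
  by rewrite -mulgA; apply: liftsM (liftsV Qk) (liftsM Pf Qk).
apply: projective_lift_hyperbolic_between.
- by move=> x y xy; rewrite !homeo_ZM; apply/QVinc/Pinc/Qinc.
- exact: homeo_Z_degree_one.
- exact: projective_lift_of QP.
- by rewrite -homeo_Z_degree_one !QVinc.
- by rewrite !homeo_ZM QVK P0.
- by rewrite !homeo_ZM QVK P1.
Qed.
End ProjectiveLifts.

(** * The affine chart of the projective line *)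

Section Models.
Variable R : realType.
Implicit Types (x y : R).

Definition mx2 (a b c d : R) : 'M[R]_2 :=
  \matrix_(i, j) (if i == 0 then (if j == 0 then a else b) else (if j == 0 then c else d)).

Lemma projective_lift_translation (c : R) : projective_lift (homeo_Z_fun (translation c)).
Proof.
exists (mx2 (cos (pi * c)) (- sin (pi * c)) (sin (pi * c)) (cos (pi * c))); split.
  by rewrite det_mx2 !mxE /= mulNr opprK -(cos2Dsin2 (pi * c)) !expr2.
move=> x; exists 1; apply/mul_directionP; rewrite !mxE /= translationE mulrDr cosD sinD.
by split; ring.
Qed.

Definition period_chart x0 (Theta : R -> R) y :=
  if y == x0 then - 2^-1 else atan (Theta y) / pi.

(** The extension of [period_chart] to a map of degree one.  As the line of [direction y] has
    slope tan (pi y), this is the function Theta on the open interval from x0 to x0 + 1, seen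
    in the affine chart of the projective line, with x0 sent to the point at infinity. *)
Definition chart x0 (Theta : R -> R) x :=
  let n := Num.floor (x - x0) in period_chart x0 Theta (x - n%:~R) + n%:~R.

Lemma fundamental_domain x0 x : exists (n : int) y, x = y + n%:~R /\ x0 <= y < x0 + 1.
Proof.
exists (Num.floor (x - x0)), (x - (Num.floor (x - x0))%:~R).
split; first by rewrite subrK.
have := floor_le (x - x0); have := floorD1_gt (x - x0); rewrite intrD; lra.
Qed.

Lemma chartE x0 Theta y (n : int) : x0 <= y < x0 + 1 ->
  chart x0 Theta (y + n%:~R) = period_chart x0 Theta y + n%:~R.
Proof.
move=> yin; rewrite /chart (_ : Num.floor _ = n); first by rewrite addrK.
by apply: floor_def; rewrite intrD; lra.
Qed.

Lemma period_chart_in x0 Theta y : x0 < y -> - 2^-1 < period_chart x0 Theta y < 2^-1.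
Proof.
move=> xy; rewrite /period_chart gt_eqF//.
rewrite ltr_pdivlMr ?pi_gt0// ltr_pdivrMr ?pi_gt0//.
by have := atan_gtNpi2 (Theta y); have := atan_ltpi2 (Theta y); lra.
Qed.

Lemma period_chart_ge x0 Theta y : x0 <= y -> - 2^-1 <= period_chart x0 Theta y < 2^-1.
Proof.
rewrite le_eqVlt => /predU1P[<-|/(period_chart_in Theta)/andP[/ltW -> ->]//].
by rewrite /period_chart eqxx; lra.
Qed.

Lemma chart_degree_one x0 Theta : degree_one (chart x0 Theta).
Proof.
move=> x; have [n [y [-> yin]]] := fundamental_domain x0 x.
by rewrite -addrA -(intrD _ n 1) !chartE// intrD addrA.
Qed.

Definition nondecreasing_on (J : set R) (Theta : R -> R) :=
  {in J &, {homo Theta : x y / x <= y}}.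

Definition onto (J : set R) (Theta : R -> R) := forall r, exists2 x, J x & Theta x = r.

Lemma chart_nondecreasing x0 Theta : nondecreasing_on [set x | x0 < x < x0 + 1] Theta ->
  {homo chart x0 Theta : x y / x <= y}.
Proof.
move=> nd x x'; have [n [y [-> yin]]] := fundamental_domain x0 x.
have [n' [y' [-> yin']]] := fundamental_domain x0 x'.
move=> yy'; rewrite !chartE//.
have h := period_chart_ge Theta (proj1 (andP yin)); have h' := period_chart_ge Theta (proj1 (andP yin')).
have [nn'|n'n|nE] := ltgtP n n'.
- have : n%:~R + 1 <= n'%:~R :> R by rewrite -(intrD _ n 1) ler_int; lia.
  lra.
- have : n'%:~R + 1 <= n%:~R :> R by rewrite -(intrD _ n' 1) ler_int; lia.
  lra.
- rewrite nE lerD2r; have {}yy' : y <= y' by move: yy'; rewrite nE lerD2r.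
  have [xy|xy] := eqVneq x0 y; first by rewrite {1}/period_chart -xy eqxx; lra.
  have {xy} xy : x0 < y by rewrite lt_neqAle xy; lra.
  rewrite /period_chart !gt_eqF//; last lra.
  rewrite ler_pM2r ?invr_gt0 ?pi_gt0//; apply: le_atan.
  by apply: nd => //; rewrite inE /=; lra.
Qed.

Lemma chart_surj x0 Theta : onto [set x | x0 < x < x0 + 1] Theta ->
  forall r, exists x, chart x0 Theta x = r.
Proof.
move=> surj r; have [n [y [-> yin]]] := fundamental_domain (- 2^-1) r.
have pi0 := @pi_gt0 R.
have [->|yn] := eqVneq y (- 2^-1).
  by exists (x0 + n%:~R); rewrite chartE ?/period_chart ?eqxx//; lra.
have yin' : - (pi / 2) < y * pi < pi / 2.
  have y1 : - 2^-1 < y by rewrite lt_neqAle eq_sym yn; lra.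
  have y2 : y < 2^-1 by lra.
  have : - 2^-1 * pi < y * pi by rewrite ltr_pM2r.
  have : y * pi < 2^-1 * pi by rewrite ltr_pM2r.
  lra.
have [x /andP[x1 x2] xE] := surj (tan (y * pi)).
exists (x + n%:~R); rewrite chartE; last by rewrite ltW.
by rewrite /period_chart gt_eqF// xE tanK ?mulfK ?gt_eqF// in_itv.
Qed.

Lemma tan_pi_lt x y : - 2^-1 < x < 2^-1 -> - 2^-1 < y < 2^-1 ->
  (tan (pi * x) < tan (pi * y)) = (x < y).
Proof.
have pi0 := @pi_gt0 R => xin yin.
have itv (z : R) : - 2^-1 < z < 2^-1 -> pi * z \in `](- (pi / 2)), (pi / 2)[.
  move=> /andP[z1 z2]; rewrite in_itv /=.
  have : pi * - 2^-1 < pi * z by rewrite ltr_pM2l.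
  have : pi * z < pi * 2^-1 by rewrite ltr_pM2l.
  lra.
by rewrite ltr_tan ?itv// ltr_pM2l.
Qed.

Lemma cos_pi_gt0 x : - 2^-1 < x < 2^-1 -> 0 < cos (pi * x).
Proof.
have pi0 := @pi_gt0 R => /andP[z1 z2]; apply: cos_gt0_pihalf.
have : pi * - 2^-1 < pi * x by rewrite ltr_pM2l.
have : pi * x < pi * 2^-1 by rewrite ltr_pM2l.
lra.
Qed.

Definition affine_lift (al be : R) := chart (- 2^-1) (fun y => al * tan (pi * y) + be).

(** An affine change of Theta is a projective change of its chart. *)
Lemma affine_lift_chart x0 Theta Theta' al be x : 0 < al ->
  (forall y, x0 < y < x0 + 1 -> Theta' y = al * Theta y + be) ->
  chart x0 Theta' x = affine_lift al be (chart x0 Theta x).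
Proof.
move=> al0 T'; have [n [y [-> yin]]] := fundamental_domain x0 x.
have := period_chart_ge Theta (proj1 (andP yin)) => h.
rewrite /affine_lift !chartE//; last by lra.
congr (_ + _); rewrite {2}/period_chart.
have [xy|xy] := eqVneq x0 y; first by rewrite -xy /period_chart !eqxx.
have x0y : x0 < y by rewrite lt_neqAle xy; lra.
have /andP[h1 _] := period_chart_in Theta x0y.
rewrite (gt_eqF h1) /period_chart gt_eqF// T'; last lra.
by rewrite mulrC [pi * _]mulrC divfK ?gt_eqF ?pi_gt0// atanK [RHS]mulrC.
Qed.

Lemma affine_lift_homeo al be : 0 < al ->
  exists2 P : homeo_Z R, {homo P : x y / x < y} & homeo_Z_fun P = affine_lift al be.
Proof.
move=> al0.
have half : - 2^-1 + 1 = 2^-1 :> R by lra.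
have inc : {homo affine_lift al be : x y / x < y}.
  move=> x x'; have [n [y [-> yin]]] := fundamental_domain (- 2^-1) x.
  have [n' [y' [-> yin']]] := fundamental_domain (- 2^-1) x'.
  move=> yy'; rewrite /affine_lift !chartE//.
  set T := fun y => _.
  have h := period_chart_ge T (proj1 (andP yin)); have h' := period_chart_ge T (proj1 (andP yin')).
  have [nn'|n'n|nE] := ltgtP n n'.
  - have : n%:~R + 1 <= n'%:~R :> R by rewrite -(intrD _ n 1) ler_int; lia.
    lra.
  - have : n'%:~R + 1 <= n%:~R :> R by rewrite -(intrD _ n' 1) ler_int; lia.
    lra.
  - have {}yy' : y < y' by move: yy'; rewrite nE ltrD2r.
    have y'0 : - 2^-1 < y' by lra.
    have g' := period_chart_in T y'0.
    rewrite nE ltrD2r {1}/period_chart; have [_|yn] := eqVneq y (- 2^-1); first by lra.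
    rewrite /period_chart (gt_eqF y'0) ltr_pM2r ?invr_gt0 ?pi_gt0//; apply: lt_atan.
    rewrite /T ltrD2r ltr_pM2l// tan_pi_lt//; last lra.
    have : - 2^-1 < y by rewrite lt_neqAle eq_sym yn; lra.
    lra.
have surj : forall r, exists x, affine_lift al be x = r.
  apply: chart_surj => r; have pi0 := @pi_gt0 R.
  exists (atan ((r - be) / al) / pi); rewrite /= ?half.
    rewrite ltr_pdivlMr ?pi_gt0// ltr_pdivrMr ?pi_gt0//.
    by have := atan_gtNpi2 ((r - be) / al); have := atan_ltpi2 ((r - be) / al); lra.
  by rewrite [pi * (_ / _)]mulrC divfK ?gt_eqF// atanK [al * _]mulrC divfK ?gt_eqF// subrK.
have [P PE] := homeo_Z_of inc surj (@chart_degree_one _ _).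
by exists P; rewrite PE.
Qed.

Lemma projective_lift_affine al be : 0 < al -> projective_lift (affine_lift al be).
Proof.
move=> al0; have pi0 := @pi_gt0 R.
pose s := Num.sqrt al.
have s0 : 0 < s by rewrite sqrtr_gt0.
have ss : s * s = al by rewrite -expr2 sqr_sqrtr// ltW.
(* the matrix of determinant 1 that acts on slopes by t |-> al * t + be *)
pose A := mx2 s^-1 0 (be / s) s.
exists A; split; first by rewrite det_mx2 !mxE /= mul0r subr0 mulVf// gt_eqF.
suff dom y : - 2^-1 <= y < - 2^-1 + 1 ->
    exists k, A *m direction y = k *: direction (affine_lift al be y).
  move=> x; have [n [y [-> yin]]] := fundamental_domain (- 2^-1) x.
  have [k kE] := dom y yin.
  have -> : affine_lift al be (y + n%:~R) = affine_lift al be y + n%:~R.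
    exact/degree_oneZ/chart_degree_one.
  have [c1 e1] := directionDz y n.
  have [c2 e2] := directionDz (affine_lift al be y + n%:~R) (- n).
  rewrite mulrNz addrK in e2.
  by exists (c1 * (k * c2)); rewrite e1 -scalemxAr kE e2 !scalerA.
move=> yin; have e0 : y = y + (0 : int)%:~R by rewrite addr0.
have -> : affine_lift al be y = period_chart (- 2^-1) (fun y => al * tan (pi * y) + be) y.
  by rewrite [in LHS]e0 /affine_lift chartE// addr0.
rewrite /period_chart; have [->|yn] := eqVneq y (- 2^-1).
  exists s; apply/mul_directionP; rewrite !mxE /= mulrN cosN cos_pihalf.
  by split; ring.
have yh : - 2^-1 < y < 2^-1.
  have : - 2^-1 < y by rewrite lt_neqAle eq_sym yn; lra.
  lra.
have C0 := cos_pi_gt0 yh.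
set T := al * tan (pi * y) + be.
have c0 : 0 < cos (atan T) by apply: cos_gt0_pihalf; rewrite atan_gtNpi2 atan_ltpi2.
have sinE : sin (atan T) = T * cos (atan T).
  have := congr1 ( *%R^~ (cos (atan T))) (atanK T).
  by rewrite /= {1}/tan divfK ?gt_eqF.
exists (cos (pi * y) / (s * cos (atan T))); apply/mul_directionP.
rewrite [pi * (_ / _)]mulrC divfK ?gt_eqF// sinE !mxE /=; split.
  by field; rewrite !gt_eqF.
rewrite /T /tan -ss; field.
by rewrite !gt_eqF//; move: c0; rewrite /T /tan -ss.
Qed.
End Models.

(** * The group of lifts and its image along a map of degree one *)

Section BorelCircle.
Variable R : realType.

Lemma measurable_open_circle (A : set (circle R)) : open A ->
  measurable (A : set (borel_circle R)).
Proof. by move=> oA; exact: sub_sigma_algebra. Qed.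

Lemma measurable_continuous_circle (f : circle R -> circle R) : continuous f ->
  measurable_fun [set: borel_circle R] (f : borel_circle R -> borel_circle R).
Proof.
move=> fc; apply: (@measurability _ _ (borel_circle R) (borel_circle R) setT f (@open (circle R)) erefl) => _ [A oA <-].
rewrite setTI; apply: measurable_open_circle.
exact: (continuousP f).1.
Qed.

Lemma probability_image (mu : probability (borel_circle R) R)
    (f : circle R -> circle R) : continuous f ->
  exists nu : probability (borel_circle R) R,
    forall A : set (borel_circle R), measurable A -> nu A = mu (f @^-1` A).
Proof.
move=> fc; pose F : borel_circle R -> borel_circle R := f.
pose mF := isMeasurableFun.Build _ _ _ _ F (measurable_continuous_circle fc).
pose X : {mfun borel_circle R >-> borel_circle R} := HB.pack F mF.
by exists (distribution mu X).
Qed.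
End BorelCircle.

(** The displacement is an integer at each point, and monotony on a period leaves one value. *)
Lemma lifts_id_translation (R : realType) (F : R -> R) :
  {homo F : x y / x < y} -> degree_one F -> lifts F id ->
  exists n : int, forall x, F x = x + n%:~R.
Proof.
move=> Finc F1 Fid; have disp x : exists n : int, F x = x + n%:~R.
  by apply/to_circleP; rewrite -Fid.
have [n nE] := disp 0; exists n => x.
have [m [y [-> /andP[y0 y1]]]] := fundamental_domain 0 x.
rewrite degree_oneZ// addrAC; congr (_ + _).
have [k kE] := disp y; rewrite add0r in y1.
have h1 : F 0 <= F y by rewrite (le_mono Finc).
have h2 : F y < F (0 + 1) by apply: Finc; rewrite add0r.
rewrite F1 nE kE in h1 h2.
have e1 : k%:~R < n%:~R + 1 :> R by lra.
have e2 : n%:~R - 1 < k%:~R :> R by lra.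
rewrite kE; congr (_ + _%:~R).
move: e1 e2; rewrite -(intrD _ n 1) -(intrB _ n 1) !ltr_int; lia.
Qed.

Section LiftedGroup.
Variables (R : realType) (G : groupClosed (homeo_plus R)).

Definition lifted : {pred homeo_Z R} := fun P =>
  `[< {homo P : x y / x < y} /\ exists2 g : homeo_plus R, g \in G & lifts P g >].

Fact lifted_closed : group_closed lifted.
Proof.
split=> [|P Q /asboolP[Pinc [g gG Pg]] /asboolP[Qinc [k kG Qk]]]; apply/asboolP.
  by split=> //; exists 1%g; first exact: gpred1.
split; last by exists (g / k)%g; [exact: gpredF|exact: liftsM Pg (liftsV Qk)].
by move=> x y xy; rewrite !homeo_ZM; apply/Pinc/homeo_ZV_inc.
Qed.

HB.instance Definition _ := isMulClosed.Build (homeo_Z R)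
  lifted (group_closedM lifted_closed).
HB.instance Definition _ := isMul1Closed.Build (homeo_Z R)
  lifted lifted_closed.1.
HB.instance Definition _ := isInvClosed.Build (homeo_Z R)
  lifted (group_closedV lifted_closed).

Definition lift_group : Type := subgroup lifted.
HB.instance Definition _ := SubGroup.on lift_group.

Definition act (F : lift_group) : R -> R := homeo_Z_fun (val F).

Lemma act_inc F : {homo act F : x y / x < y}.
Proof. by have /asboolP[] := valP F. Qed.

Lemma act_lifts F : exists2 g : homeo_plus R, g \in G & lifts (act F) g.
Proof. by have /asboolP[] := valP F. Qed.

Lemma actD F x (n : int) : act F (x + n%:~R) = act F x + n%:~R.
Proof. exact: homeo_ZD. Qed.

Lemma act_line_action : line_action act.
Proof. by split=> // F x y; exact: act_inc. Qed.

Lemma lift_group_inj (F K : lift_group) : (forall x, act F x = act K x) -> F = K.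
Proof. by move=> FK; apply/val_inj/homeo_Z_inj. Qed.

Lemma lift_of (g : subgroup G) : exists F : lift_group, lifts (act F) (homeo_plus_fun (val g)).
Proof.
have [P Pinc Pg] := lift_exists (val g).
have PG : P \in lifted by apply/asboolP; split=> //; exists (val g) => //; exact: (valP g).
by exists (exist _ P PG).
Qed.

Lemma deck_proof (n : int) : translation (n%:~R : R) \in lifted.
Proof.
apply/asboolP; split=> [x y|]; first by rewrite !translationE ltrD2r.
exists 1%g; first exact: gpred1.
by move=> x; rewrite translationE to_circleDz.
Qed.

Definition deck (n : int) : lift_group := exist _ (translation n%:~R) (deck_proof n).

Lemma deckE n x : act (deck n) x = x + n%:~R.
Proof. exact: translationE. Qed.

Lemma deckD m n : deck (m + n) = (deck m * deck n)%g.
Proof.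
apply: lift_group_inj => x; rewrite (actM act_line_action) !deckE.
by rewrite intrD addrA addrAC.
Qed.

Lemma deck_inj : injective deck.
Proof.
move=> m n /(congr1 (fun F => act F 0)); rewrite !deckE !add0r.
exact: intr_inj.
Qed.

Lemma deck_commute n F : commute (deck n) F.
Proof.
by apply: lift_group_inj => x; rewrite !(actM act_line_action) !deckE actD.
Qed.

Lemma lifts_id_deck F : lifts (act F) id -> exists n, F = deck n.
Proof.
move=> F1; have [n nE] := lifts_id_translation (@act_inc F) (fun x => actD F x 1) F1.
by exists n; apply: lift_group_inj => x; rewrite deckE.
Qed.

Lemma proj_exists F : exists g : subgroup G, lifts (act F) (homeo_plus_fun (val g)).
Proof. by have [g gG Fg] := act_lifts F; exists (exist _ g gG). Qed.

Definition lift_proj F : subgroup G := sval (cid (proj_exists F)).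

Lemma lift_projP F : lifts (act F) (homeo_plus_fun (val (lift_proj F))).
Proof. by rewrite /lift_proj; case: cid. Qed.

Lemma lift_proj_uniq F (g : subgroup G) : lifts (act F) (homeo_plus_fun (val g)) -> lift_proj F = g.
Proof.
move=> Fg; apply/val_inj/homeo_plus_inj.
exact: lifts_inj (lift_projP F) Fg.
Qed.

Lemma lift_projM : {morph lift_proj : F K / (F * K)%g}.
Proof.
by move=> F K; apply: lift_proj_uniq; exact: liftsM (lift_projP F) (lift_projP K).
Qed.

Lemma lift_central_extension : central_extension_by_Z deck lift_proj.
Proof.
split.
- exact: deckD.
- exact: deck_inj.
- apply/seteqP; split=> [_ [n _ <-]|F /= F1].
    by apply: lift_proj_uniq => x; rewrite deckE to_circleDz.
  have [|n ->] := @lifts_id_deck F; last by exists n.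
  by have := lift_projP F; rewrite F1.
- apply/seteqP; split=> // g _; have [F Fg] := lift_of g.
  by exists F => //; exact: lift_proj_uniq.
- exact: deck_commute.
Qed.
End LiftedGroup.

Section Reduction.
Variables (R : realType) (G : groupClosed (homeo_plus R)).
Local Notation Gt := (lift_group G).

Variable h : R -> R.
Hypotheses (h_nd : {homo h : x y / x <= y}) (h_surj : forall y, exists x, h x = y).
Hypothesis h1 : degree_one h.

Definition mobius_along (F : R -> R) := exists P : homeo_Z R,
  [/\ {homo P : x y / x < y}, projective_lift P & forall x, h (F x) = P (h x)].

Lemma mobius_along_comp F K : mobius_along F -> mobius_along K -> mobius_along (F \o K).
Proof.
move=> [P [Pinc Pp PE]] [Q [Qinc Qp QE]]; exists (P * Q)%g; split.
- by move=> x y xy; rewrite !homeo_ZM; apply/Pinc/Qinc.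
- exact: projective_liftM Pp Qp.
- by move=> x /=; rewrite PE QE.
Qed.

Lemma mobius_along_translation (F : R -> R) c : (forall x, h (F x) = h x + c) -> mobius_along F.
Proof.
move=> FE; exists (translation c); split.
- by move=> x y; rewrite !translationE ltrD2r.
- exact: projective_lift_translation.
- by move=> x; rewrite translationE.
Qed.

Let hc := nondecreasing_surj_continuous h_nd h_surj.

Lemma degree_one_cvg_pinfty : `|h x| @[x --> +oo] --> +oo.
Proof.
have h_up x : h x <= `|h x| by exact: ler_norm.
apply/cvgryPge => A; have [a aA] := h_surj A.
near=> x; apply: (le_trans _ (h_up x)); rewrite -aA; apply: h_nd.
by near: x; apply: nbhs_pinfty_ge; exact: num_real.
Unshelve. all: by end_near.
Qed.

Lemma degree_one_cvg_ninfty : `|h x| @[x --> -oo] --> +oo.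
Proof.
have h_up x : - h x <= `|h x| by rewrite -normrN; exact: ler_norm.
apply/cvgryPge => A; have [a aA] := h_surj (- A).
near=> x; apply: (le_trans _ (h_up x)); rewrite lerNr -aA; apply: h_nd.
by near: x; apply: nbhs_ninfty_le; exact: num_real.
Unshelve. all: by end_near.
Qed.

Hypothesis h_mobius : forall F : Gt, mobius_along (act F).
Hypothesis h_faithful : forall F : Gt, (forall x, h (act F x) = h x) -> F = 1%g.

(** Since h is onto, each element of the group has exactly one projective image along h, on the
    line and on the circle; uniqueness makes the images into morphisms, on the extension and
    on G. *)
Theorem semiconjugacy_of_map : elementary [set g | g \in G] ->
  exists psi : {multiplicative subgroup G -> PSL2 R},
    [/\ injective psi,
        elementary (range (fun g => val (psi g)))
      & continuously_semiconjugate (fun g : subgroup G => val g)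
          (fun g => val (psi g))].
Proof.
move=> [mu muG].
pose psit F : homeo_Z R := sval (cid (h_mobius F)).
have psitP F : [/\ {homo psit F : x y / x < y}, projective_lift (homeo_Z_fun (psit F)) &
    forall x, h (act F x) = psit F (h x)] by rewrite /psit; case: cid.
have psitE F x : h (act F x) = psit F (h x) by case: (psitP F).
have psitM : {morph psit : F K / (F * K)%g}.
  move=> F K; apply: homeo_Z_inj => y; have [x <-] := h_surj y.
  by rewrite homeo_ZM -!psitE.
have [hb hbc hbE] := descends_continuous hc h1.
have hb_surj p : exists q, hb q = p.
  have [y <-] := to_circle_surj p; have [x <-] := h_surj y.
  by exists (to_circle x).
have psi_ex (g : subgroup G) : exists q : PSL2 R,
    forall p, hb (homeo_plus_fun (val g) p) = homeo_plus_fun (val q) (hb p).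
  have [F Fg] := lift_of g; have [Pinc Pp PE] := psitP F.
  have [f Pf] := descends Pinc.
  have fp : f \in @is_projective R by exact: projective_of_lift Pp Pf.
  exists (exist _ f fp) => p; have [x <-] := to_circle_surj p.
  by rewrite Fg !hbE PE Pf.
pose psi g : PSL2 R := sval (cid (psi_ex g)).
have psiE g p : hb (homeo_plus_fun (val g) p) = homeo_plus_fun (val (psi g)) (hb p).
  by rewrite /psi; case: cid.
have psiM : {morph psi : g k / (g * k)%g}.
  move=> g k; apply/val_inj/homeo_plus_inj/funext => p; have [q <-] := hb_surj p.
  by rewrite -psiE [RHS]homeo_plusM -!psiE.
have psi_inj : forall g, psi g = 1%g -> g = 1%g.
  move=> g g1; have [F Fg] := lift_of g.
  have [Pinc _ PE] := psitP F.
  have P1 : lifts (homeo_Z_fun (psit F)) id.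
    move=> y; have [x <-] := h_surj y.
    by rewrite -PE -!hbE -Fg psiE g1.
  have [n Pn] := lifts_id_translation Pinc (@homeo_Z_degree_one R (psit F)) P1.
  have nE x : h (act F x) = h x + n%:~R by rewrite PE Pn.
  have F1 : (deck G (- n) * F)%g = 1%g.
    apply: h_faithful => x; rewrite (actM (act_line_action G)) deckE.
    by rewrite degree_oneZ// nE mulrNz addrK.
  have FE : F = deck G n.
    rewrite -[F](mulKg (deck G (- n))) F1 mulg1; apply/mulg1_eq; rewrite -deckD addNr.
    by apply: lift_group_inj => x; rewrite deckE addr0.
  rewrite -(lift_proj_uniq Fg) FE; apply: lift_proj_uniq => x.
  by rewrite deckE to_circleDz.
pose psi' : {multiplicative subgroup G -> PSL2 R} :=
  HB.pack psi (isMultiplicative.Build _ _ psi psiM).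
exists psi'; split.
- move=> g k e; apply: divg1_eq; apply: psi_inj; apply: (@mulIg _ (psi k)).
  by rewrite -psiM mulgVK mul1g.
- have [nu nuE] := probability_image mu hbc.
  exists nu => _ [g _ <-] A mA.
  have m_psi : measurable (homeo_plus_fun (val (psi g)) @^-1` A : set (borel_circle R)).
    rewrite -[X in measurable X]setTI.
    exact: (measurable_continuous_circle (@homeo_plus_continuous R (val (psi g))) measurableT mA).
  have m_hb : measurable (hb @^-1` A : set (borel_circle R)).
    by rewrite -[X in measurable X]setTI; exact: (measurable_continuous_circle hbc measurableT mA).
  rewrite nuE// nuE// -(muG (val g) (valP g) _ m_hb).
  by congr (mu _); apply/seteqP; split=> p /=; rewrite psiE.
- exists Gt, (@deck R G).
  pose pM : {multiplicative Gt -> subgroup G} :=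
    HB.pack (@lift_proj R G) (isMultiplicative.Build _ _ (@lift_proj R G) (@lift_projM R G)).
  pose valM : {multiplicative Gt -> homeo_Z R} :=
    HB.pack (val : Gt -> homeo_Z R) (isMultiplicative.Build Gt (homeo_Z R) val (fun _ _ => erefl)).
  pose psitM' : {multiplicative Gt -> homeo_Z R} :=
    HB.pack psit (isMultiplicative.Build _ _ psit psitM).
  exists pM, valM, psitM', h; split.
  + exact: lift_central_extension.
  + move=> F; split; first exact: lift_projP.
    move=> y; have [x <-] := h_surj y.
    by rewrite -hbE -psiE lift_projP hbE psitE.
  + move=> n x; split; first exact: deckE.
    have [z <-] := h_surj x; rewrite -psitE deckE.
    exact: degree_oneZ.
  + by split=> //; [exact: degree_one_cvg_pinfty|exact: degree_one_cvg_ninfty].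
  + by move=> F x; exact: psitE.
Qed.
End Reduction.

(** * Invariant maps and invariant measures *)

Section Dynamics.
Variables (R : realType) (G : groupClosed (homeo_plus R)).
Hypothesis hM : mobius_like [set g | g \in G].
Local Notation Gt := (lift_group G).
Let ha := act_line_action G.

Lemma lift_group_eq1 (F : Gt) x0 : act F x0 = x0 ->
  (forall x, x0 < x < x0 + 1 -> act F x = x) -> F = 1%g.
Proof.
move=> F0 Fx; apply: lift_group_inj => x; rewrite (act1 ha).
have [n [y [-> yin]]] := fundamental_domain x0 x; rewrite actD; congr (_ + _).
have [->//|neq] := eqVneq y x0; apply: Fx.
by have : x0 < y; [rewrite lt_neqAle eq_sym neq; lra|lra].
Qed.

Lemma two_fixed_points (F : Gt) x0 x1 : F <> 1%g -> x0 < x1 < x0 + 1 ->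
  act F x0 = x0 -> act F x1 = x1 ->
  (forall x, x0 < x < x1 -> x < act F x) /\ (forall x, x1 < x < x0 + 1 -> act F x < x) \/
  (forall x, x0 < x < x1 -> act F x < x) /\ (forall x, x1 < x < x0 + 1 -> x < act F x).
Proof.
move=> F1 x01 F0 Fx1; have [g gG Fg] := act_lifts F.
have [/(lift_group_eq1 F0)//||] :=
  mobius_hyperbolic_between (hM gG) (@act_inc _ _ F) Fg x01 F0 Fx1; by [left|right].
Qed.

Lemma third_fixed_point (F : Gt) x0 x1 x2 : x0 < x1 < x0 + 1 -> x0 < x2 < x0 + 1 ->
  act F x0 = x0 -> act F x1 = x1 -> act F x2 = x2 -> x1 <> x2 -> F = 1%g.
Proof.
move=> x01 x02 F0 F1 F2 x12; apply: contrapT => Fn1.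
have [[h1 h2]|[h1 h2]] := two_fixed_points Fn1 x01 F0 F1;
  have [lt|lt|//] := ltgtP x1 x2.
- have := h2 x2; rewrite F2; lra.
- have := h1 x2; rewrite F2; lra.
- have := h2 x2; rewrite F2; lra.
- have := h1 x2; rewrite F2; lra.
Qed.

Lemma gap_image (F : Gt) l r x : act F l = l -> act F r = r -> l < x < r -> l < act F x < r.
Proof. by move=> Fl Fr /andP[lx xr]; rewrite -{1}Fl -{1}Fr !(act_ltE ha) lx. Qed.

Lemma invariant_on_gap d (T : porderType d) (u : R -> T) (F : Gt) l r x y :
  act F l = l -> act F r = r -> (forall z, l < z < r -> act F z <> z) ->
  (forall z w, l < z < r -> l < w < r -> z <= w -> (u z <= u w)%O) ->
  (forall z, l < z < r -> u (act F z) = u z) -> l < x < r -> l < y < r -> u x = u y.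
Proof.
move=> Fl Fr nofix und uF; pose J := [set z | l < z < r].
have intJ : is_interval J by exact: is_interval_open.
have und' : {in J &, {homo u : z w / z <= w >-> (z <= w)%O}}.
  by move=> z w; rewrite !inE; exact: und.
have [up|down] := act_sign ha intJ nofix.
  by apply: (invariant_constant ha intJ _ up und' uF) => z; exact: gap_image.
have FJ z : J z -> J (act F^-1%g z) by apply: gap_image; exact: (actV_fix ha).
apply: (invariant_constant ha (g := F^-1%g) intJ FJ _ und') => z Jz.
  by rewrite (lt_actV ha); exact: down.
by rewrite -[in RHS](actKV ha F z) uF//; exact: FJ.
Qed.

Section InvariantMap.
Variables (h : R -> R) (F : Gt).
Hypotheses (h_nd : {homo h : x y / x <= y}) (h_surj : forall y, exists x, h x = y).
Hypotheses (h1 : degree_one h) (hF : forall x, h (act F x) = h x).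

(** The map h is constant in the gap, and it cannot jump at the ends since it is onto. *)
Lemma invariant_map_gap l r : l < r -> act F l = l -> act F r = r ->
  (forall z, l < z < r -> act F z <> z) -> h l = h r.
Proof.
move=> lr Fl Fr nofix; pose m := (l + r) / 2.
have lmr : l < m < r by rewrite /m; lra.
have hm x : l < x < r -> h x = h m.
  move=> lxr; apply: (invariant_on_gap Fl Fr nofix) lxr lmr => // z w _ _; exact: h_nd.
have /andP[/ltW/h_nd lem /ltW/h_nd mle] := lmr.
have skip v : h l < v < h r -> v = h m.
  move=> /andP[lv vr]; have [z zE] := h_surj v.
  rewrite -zE; apply: hm; apply/andP; split; rewrite ltNge; apply/negP => /h_nd; lra.
have [lt|lt|//] := ltgtP (h l) (h r); last lra.
have := skip ((2 * h l + h r) / 3) ltac:(lra); have := skip ((h l + 2 * h r) / 3) ltac:(lra).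
lra.
Qed.

(** Between consecutive fixed points of F the values of h agree; as there are finitely many of
    them modulo 1, this would give h x0 = h (x0 + 1).  Without fixed points an orbit would be
    unbounded. *)
Lemma invariant_map_trivial : F = 1%g.
Proof.
apply: contrapT => F1.
have hX n x : h (act (F ^+ n)%g x) = h x.
  by elim: n => [|n ih]; rewrite ?(act1 ha)// expgS (actM ha) hF.
have hXV n x : h (act (F^-1 ^+ n)%g x) = h x.
  by rewrite expVgn -[in RHS](actKV ha (F ^+ n)%g x) hX.
have [[x0 F0]|nofix] := pselect (exists x0, act F x0 = x0); last first.
  have intT : is_interval [set: R] by [].
  have far (k : Gt) n : ~ 2 < act (k ^+ n)%g 0 \/ h (act (k ^+ n)%g 0) <> h 0.
    apply/not_andP => -[/ltW/h_nd lt e]; move: lt; rewrite e (_ : 2 = 0 + 1 + 1); last lra.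
    rewrite !h1; lra.
  have [|up|down] := @act_sign _ _ _ ha [set: R] F intT.
    by move=> x _ Fx; apply: nofix; exists x.
    have [n] := orbit_unbounded ha intT (fun _ _ => I) up (I : setT 0) (I : setT 2).
    by case: (far F n) => // h3; rewrite hX in h3.
  have up z : setT z -> z < act F^-1%g z by move=> _; rewrite (lt_actV ha); exact: down.
  have [n] := orbit_unbounded ha intT (fun _ _ => I) up (I : setT 0) (I : setT 2).
  by case: (far F^-1%g n) => // h3; rewrite hXV in h3.
have F01 : act F (x0 + 1) = x0 + 1 by rewrite (actD F x0 1) F0.
have [[x1 [x01 Fx1]]|nofix] := pselect (exists x1, x0 < x1 < x0 + 1 /\ act F x1 = x1).
  have e1 : h x0 = h x1.
    apply: invariant_map_gap => //; first lra.
    by move=> z zin Fz; have := two_fixed_points F1 x01 F0 Fx1 => -[] [/(_ z zin) + _];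
      rewrite Fz ltxx.
  have e2 : h x1 = h (x0 + 1).
    apply: invariant_map_gap => //; first lra.
    by move=> z zin Fz; have := two_fixed_points F1 x01 F0 Fx1 => -[] [_ /(_ z zin)];
      rewrite Fz ltxx.
  by move: e2; rewrite h1; lra.
have : h x0 = h (x0 + 1).
  apply: invariant_map_gap => //; first lra.
  by move=> z zin Fz; apply: nofix; exists z.
by rewrite h1; lra.
Qed.
End InvariantMap.

Section InvariantMeasure.
Variable mu : probability (borel_circle R) R.
Hypothesis muG : forall g : homeo_plus R, g \in G ->
  forall A : set (borel_circle R), measurable A -> mu (g @^-1` A) = mu A.

Definition arc (x y : R) : set (borel_circle R) := [set to_circle z | z in [set z | x < z < y]].

Lemma measurable_arc x y : measurable (arc x y).
Proof.
apply: measurable_open_circle; rewrite /open /= /quotient_open.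
rewrite (_ : _ @^-1` _ = \bigcup_(n : int) ((fun z => z + n%:~R) @^-1` `]x, y[)); last first.
  apply/seteqP; split=> [z [w wxy]|z [n _ zn]].
    move=> /esym/to_circleP[n zE]; exists (- n) => //=.
    by rewrite zE mulrNz addrK in_itv.
  by exists (z + n%:~R); [move: zn => /=; rewrite in_itv|exact: to_circleDz].
apply: bigcup_open => n _; apply: open_comp; last exact: interval_open.
by move=> z _; apply: cvgD; [exact: cvg_id|exact: cvg_cst].
Qed.

Lemma measurable_point x : measurable ([set to_circle x] : set (borel_circle R)).
Proof.
rewrite (_ : [set _] = ~` arc x (x + 1)); first by apply: measurableC; exact: measurable_arc.
apply/seteqP; split=> [_ -> [z zin /to_circleP[n zE]]|p /= px].
  move: zin => /=; rewrite zE => /andP[h1 h2].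
  have : 0 < n%:~R :> R by lra.
  have : n%:~R < 1%:~R :> R by lra.
  by rewrite ltr0z ltr_int; lia.
have [y yE] := to_circle_surj p.
have [n [z [yz zin]]] := fundamental_domain x y.
move: yE; rewrite yz to_circleDz => pz.
have [zx|zx] := eqVneq z x; first by rewrite -pz zx.
case: px; exists z => //=.
by have : x < z; [rewrite lt_neqAle eq_sym zx; lra|lra].
Qed.

Definition mass x := mu [set to_circle x].

Lemma mass_act (F : Gt) x : mass (act F x) = mass x.
Proof.
have [g gG Fg] := act_lifts F.
rewrite /mass -(muG gG (measurable_point _)); congr (mu _).
apply/seteqP; split=> [p /= pE| _ ->] /=; last exact: Fg.
by apply: (can_inj (homeoK (val g))); rewrite -[RHS]/(homeo_plus_fun g _) Fg.
Qed.

(** The measure of the arc from l to y does not depend on y in the gap, because F moves y while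
    preserving the measure.  Letting y tend to l, it is 0; letting y tend to r, so is the
    measure of the whole gap. *)
Lemma mu_gap (F : Gt) l r : l < r <= l + 1 -> act F l = l -> act F r = r ->
  (forall z, l < z < r -> act F z <> z) -> mu (arc l r) = 0%E.
Proof.
move=> /andP[lr rl] Fl Fr nofix.
have [g gG Fg] := act_lifts F.
have sub z w : z <= w -> arc l z `<=` arc l w.
  by move=> zw _ [x /andP[lx xz] <-]; exists x => //=; rewrite lx (lt_le_trans xz).
pose m := (l + r) / 2.
have lmr : l < m < r by rewrite /m; lra.
have const y : l < y < r -> mu (arc l y) = mu (arc l m).
  move=> lyr; apply: (invariant_on_gap (u := fun y => mu (arc l y)) Fl Fr nofix) lyr lmr.
    move=> z w _ _ /sub zw; apply: le_measure => //; rewrite inE; exact: measurable_arc.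
  move=> z lzr; rewrite -(muG gG (measurable_arc _ _)); congr (mu _).
  apply/seteqP; split=> [p /= [w /andP[lw wz] wE]|_ [w /andP[lw wz] <-]] /=.
    exists (act F^-1%g w).
      by rewrite /= (actV_lt ha) wz andbT (lt_actV ha) Fl.
    apply: (can_inj (homeoK (val g))); rewrite -[LHS]/(homeo_plus_fun g _) Fg (actKV ha).
    exact: wE.
  by exists (act F w); [rewrite /= (act_ltE ha) wz -[X in X < _]Fl (act_ltE ha) lw|rewrite Fg].
have const0 : mu (arc l m) = 0%E.
  pose A n := arc l (Num.min m (l + n.+1%:R^-1)).
  have lA n : l < Num.min m (l + n.+1%:R^-1) < r.
    by rewrite lt_min gt_min ltrDl invr_gt0 ltr0n; move: lmr => /andP[-> ->].
  have capA : \bigcap_n A n = set0.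
    apply/seteqP; split=> // p pA; have [z /andP[lz zm] pE] := pA 0%N I.
    have [k zk] := ltr_add_invr lz.
    have [w /andP[lw wk] wE] := pA k I.
    have [n wzn] : exists n : int, w = z + n%:~R by apply/to_circleP; rewrite wE pE.
    move: zm wk; rewrite !lt_min => /andP[zm _] /andP[wm wk].
    have lo : (-1)%:~R < n%:~R :> R by rewrite mulrNz; move: lmr; lra.
    have hi : n%:~R < 1%:~R :> R by move: lmr; lra.
    have n0 : n = 0 by move: lo hi; rewrite !ltr_int; lia.
    by move: wk; rewrite wzn n0 addr0 => /(lt_trans zk); rewrite ltxx.
  have : mu \o A @ \oo --> mu (\bigcap_n A n).
    apply: nonincreasing_cvg_mu.
    - by apply: le_lt_trans (ltry 1); apply: probability_le1; exact: measurable_arc.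
    - by move=> n; exact: measurable_arc.
    - by rewrite capA; exact: measurable0.
    - move=> i j ij; rewrite /A; apply/subsetPset/sub.
      rewrite le_min !ge_min lexx /= lerD2l lef_pV2 ?posrE ?ltr0n// ler_nat ltnS ij orbT//.
  rewrite capA measure0 (_ : mu \o A = cst (mu (arc l m))); last first.
    by apply/funext => n /=; exact: const.
  by move=> /(cvg_lim (@ereal_hausdorff R)); rewrite lim_cst//; exact: ereal_hausdorff.
pose B n := arc l (Num.max m (r - n.+1%:R^-1)).
have lB n : l < Num.max m (r - n.+1%:R^-1) < r.
  by rewrite lt_max gt_max gtrBl invr_gt0 ltr0n; move: lmr => /andP[-> ->].
apply: measure_negligible; first exact: measurable_arc.
apply: (@negligibleS _ _ _ mu (\bigcup_n B n)).
  move=> _ [z /andP[lz zr] <-].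
  have [k zk] := ltr_add_invr zr; exists k => //; exists z => //=.
  by rewrite lz lt_max ltrBrDr zk orbT.
apply: negligible_bigcup => n; apply/negligibleP; first exact: measurable_arc.
exact: etrans (const _ (lB n)) const0.
Qed.

Lemma arc_point l r x : l < x < r -> [set to_circle x] `<=` arc l r.
Proof. by move=> lxr _ ->; exists x. Qed.

Lemma mass_gap (F : Gt) l r x : l < r <= l + 1 -> act F l = l -> act F r = r ->
  (forall z, l < z < r -> act F z <> z) -> l < x < r -> mass x = 0%E.
Proof.
move=> lr Fl Fr nofix lxr; apply: measure_negligible; first exact: measurable_point.
apply: (@negligibleS _ _ _ mu (arc l r)); first exact: arc_point; apply/negligibleP; first exact: measurable_arc.
exact: mu_gap lr Fl Fr nofix.
Qed.

Lemma massDz x (n : int) : mass (x + n%:~R) = mass x.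
Proof. by rewrite /mass to_circleDz. Qed.

(** The gaps between the fixed points of F0, of which there are at most two modulo 1, have
    measure 0.  Hence one fixed point d has positive mass; the other points of its orbit have
    the same mass, so they cannot lie in the gaps. *)
Lemma fixed_orbit (F0 : Gt) x0 : F0 <> 1%g -> act F0 x0 = x0 ->
  exists d, forall F : Gt, act F0 (act F d) = act F d.
Proof.
move=> F1 Fx0.
have F01 : act F0 (x0 + 1) = x0 + 1 by rewrite (actD F0 x0 1) Fx0.
have reduce : (exists2 d, mass d <> 0%E & act F0 d = d) ->
    (forall x, x0 <= x < x0 + 1 -> act F0 x <> x -> mass x = 0%E) ->
    exists d, forall F : Gt, act F0 (act F d) = act F d.
  move=> [d d0 Fd] null; exists d => F; apply: contrapT => nofix; apply: d0.
  rewrite -(mass_act F); have [n [y [yE yin]]] := fundamental_domain x0 (act F d).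
  rewrite yE massDz; apply: null => // Fy; apply: nofix.
  by rewrite yE actD Fy.
have point_null x : mass x = 0%E -> mu.-negligible [set to_circle x].
  by move=> x0'; apply/negligibleP => //; exact: measurable_point.
have arc_null l r : mu (arc l r) = 0%E -> mu.-negligible (arc l r).
  by move=> x0'; apply/negligibleP => //; exact: measurable_arc.
have not_null : ~ mu.-negligible [set: borel_circle R].
  move=> /(measure_negligible measurableT) m0; have := etrans (esym m0) (probability_setT mu).
  by move=> /eqP; rewrite eq_sym onee_eq0.
have [[x1 [x01 Fx1]]|nofix] := pselect (exists x1, x0 < x1 < x0 + 1 /\ act F0 x1 = x1); last first.
  have {}nofix z : x0 < z < x0 + 1 -> act F0 z <> z by move=> zin Fz; apply: nofix; exists z.
  have gap : mu (arc x0 (x0 + 1)) = 0%E by apply: (mu_gap _ Fx0 F01 nofix); lra.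
  apply: reduce.
    exists x0 => // m0; apply: not_null.
    apply: (@negligibleS _ _ _ mu ([set to_circle x0] `|` arc x0 (x0 + 1))).
      move=> p _; have [x <-] := to_circle_surj p.
      have [n [y [-> yin]]] := fundamental_domain x0 x; rewrite to_circleDz.
      have [->|yx] := eqVneq y x0; [by left|right; exists y => //=].
      by have : x0 < y; [rewrite lt_neqAle eq_sym yx; lra|lra].
    by apply: negligibleU; [exact: point_null|exact: arc_null].
  move=> x xin Fx; have xx0 : x != x0 by apply/eqP => e; apply: Fx; rewrite e.
  apply: (mass_gap _ Fx0 F01 nofix); first lra.
  by have : x0 < x; [rewrite lt_neqAle eq_sym xx0; lra|lra].
have no1 z : x0 < z < x1 -> act F0 z <> z.
  move=> zin Fz; have := two_fixed_points F1 x01 Fx0 Fx1 => -[] [/(_ z zin) + _];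
    by rewrite Fz ltxx.
have no2 z : x1 < z < x0 + 1 -> act F0 z <> z.
  move=> zin Fz; have := two_fixed_points F1 x01 Fx0 Fx1 => -[] [_ /(_ z zin)];
    by rewrite Fz ltxx.
have gap1 : mu (arc x0 x1) = 0%E by apply: (mu_gap _ Fx0 Fx1 no1); lra.
have gap2 : mu (arc x1 (x0 + 1)) = 0%E by apply: (mu_gap _ Fx1 F01 no2); lra.
have cases y : x0 <= y < x0 + 1 -> [\/ y = x0, y = x1, x0 < y < x1 | x1 < y < x0 + 1].
  move=> yin; have [lt|lt|->] := ltgtP y x1; last by constructor 2.
    have [->|yx] := eqVneq y x0; first by constructor 1.
    by constructor 3; have : x0 < y; [rewrite lt_neqAle eq_sym yx; lra|lra].
  by constructor 4; lra.
apply: reduce.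
  apply: contrapT => none; apply: not_null.
  have m0 : mass x0 = 0%E by apply: contrapT => m; apply: none; exists x0.
  have m1 : mass x1 = 0%E by apply: contrapT => m; apply: none; exists x1.
  apply: (@negligibleS _ _ _ mu (([set to_circle x0] `|` [set to_circle x1]) `|`
                            (arc x0 x1 `|` arc x1 (x0 + 1)))).
    move=> p _; have [x <-] := to_circle_surj p.
    have [n [y [-> yin]]] := fundamental_domain x0 x; rewrite to_circleDz.
    case: (cases y yin) => [->|->|yin'|yin']; [by left; left|by left; right| |].
      by right; left; exists y.
    by right; right; exists y.
  apply: negligibleU; apply: negligibleU; [exact: point_null..|exact: arc_null|exact: arc_null].
move=> x xin Fx; case: (cases x xin) => [xE|xE|xin'|xin'].
- by case: Fx; rewrite xE.
- by case: Fx; rewrite xE.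
- by apply: (mass_gap _ Fx0 Fx1 no1) => //; lra.
- by apply: (mass_gap _ Fx1 F01 no2) => //; lra.
Qed.
End InvariantMeasure.
End Dynamics.

(** * Construction of the semi-conjugacy *)

Section Construction.
Variables (R : realType) (G : groupClosed (homeo_plus R)).
Hypothesis hM : mobius_like [set g | g \in G].
Local Notation Gt := (lift_group G).
Let ha := act_line_action G.

(** Existence of the map h from which the semi-conjugacy is built. *)
Definition has_model := exists h : R -> R,
  [/\ {homo h : x y / x <= y}, forall y, exists x, h x = y, degree_one h &
      forall F : Gt, mobius_along h (act F)].

Lemma free_has_model : (forall (F : Gt) x, act F x = x -> F = 1%g) -> has_model.
Proof.
move=> free; pose J := [set: R]; pose S := [set: Gt].
have hS : is_subgroup S by [].
have intJ : is_interval J by [].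
have hfree : acts_freely (@act _ G) S J.
  split=> // F _; have [->|F1] := pselect (F = 1%g); first by constructor 1.
  have [x _ Fx|up|down] := act_sign ha (g := F) intJ; [|by constructor 2|by constructor 3].
  by apply: F1; apply: free Fx.
have t0 : 0 < act (deck G 1) 0 by rewrite deckE add0r.
have [tau htau] := free_order_morphism ha hS hfree intJ (I : S _) (I : J 0) t0.
have [th [nd surj eqv]] := free_semiconjugacy ha hS hfree htau intJ (I : J 0) (I : S _) t0.
pose c := tau (deck G 1).
have c0 : 0 < c by rewrite /c -(tau_pos ha hS hfree htau (x := 0)).
exists (fun x => th x / c); split.
- by move=> x y xy; rewrite ler_pM2r ?invr_gt0//; apply: nd; rewrite ?inE.
- by move=> y; have [x _ xE] := surj (y * c); exists x; rewrite xE mulfK// gt_eqF.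
- move=> x; have := eqv (deck G 1) x I I; rewrite deckE => ->.
  by rewrite mulrDl divff// gt_eqF.
- move=> F; apply: (mobius_along_translation (c := tau F / c)) => x.
  by rewrite eqv// mulrDl.
Qed.

Lemma atanV (x : R) : 0 < x -> atan x^-1 = pi / 2 - atan x.
Proof.
move=> x0; have t0 : 0 < atan x by rewrite -atan0; exact: lt_atan.
have t1 := atan_ltpi2 x; have pi0 := @pi_gt0 R.
rewrite -[RHS]tanK; last by rewrite in_itv /=; lra.
congr atan; rewrite /tan -[pi / 2 - _]opprB sinN cosN sinBpihalf cosBpihalf opprK.
by rewrite -[in LHS](atanK x) /tan invf_div.
Qed.

Section FixedPoint.
Variable d : R.

Definition stabilizer := [set F : Gt | act F d = d].
Local Notation Gamma := stabilizer.

Lemma stabilizer_subgroup : is_subgroup Gamma.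
Proof.
split; first exact: (act1 ha).
- by move=> F K Fd Kd; rewrite /stabilizer /= (actM ha) (Kd : act K d = d).
- by move=> F; exact: (actV_fix ha).
Qed.

Lemma stabilizer_end (F : Gt) : Gamma F -> act F (d + 1) = d + 1.
Proof. by move=> Fd; rewrite (actD F d 1) Fd. Qed.

Lemma stabilizer_affine_like : affine_like (@act _ G) Gamma d (d + 1).
Proof.
split=> [F x Fd|F c Fd dcd Fc]; first by apply: gap_image => //; exact: stabilizer_end.
have [->|F1] := pselect (F = 1%g); first by constructor 1.
have [[h1 h2]|[h1 h2]] := two_fixed_points hM F1 dcd Fd Fc.
  constructor 3; split=> //; first exact: (actV_fix ha).
  - by move=> x /h1; rewrite (actV_lt ha).
  - by move=> x /h2; rewrite (lt_actV ha).
by constructor 2.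
Qed.

Variable Theta : R -> R.
Let J := [set x | d < x < d + 1].
Hypotheses (Th_nd : nondecreasing_on J Theta) (Th_onto : onto J Theta).
Let h := chart d Theta.

(** Affine along Theta means projective along the chart of Theta. *)
Lemma chart_mobius_along F al be : Gamma F -> 0 < al ->
  (forall x, d < x < d + 1 -> Theta (act F x) = al * Theta x + be) ->
  mobius_along h (act F).
Proof.
move=> Fd al0 FE; have [P Pinc PE] := affine_lift_homeo be al0.
exists P; split=> //; first by rewrite PE; exact: projective_lift_affine.
move=> x; rewrite PE -(affine_lift_chart (Theta' := Theta \o act F) x al0 FE).
have [n [y [-> yin]]] := fundamental_domain d x.
have Fy : d <= act F y < d + 1.
  by rewrite -[X in X <= _](Fd : act F d = d) (act_leE ha) -(stabilizer_end Fd) (act_ltE ha).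
rewrite actD /h !chartE// /period_chart; congr (_ + _).
have -> // : (act F y == d) = (y == d).
by rewrite -[in LHS](Fd : act F d = d) (inj_eq (@act_inj _ _ _ ha F)).
Qed.

Lemma chart_mobius_along_deck n : mobius_along h (act (deck G n)).
Proof.
apply: (mobius_along_translation (c := n%:~R)) => x; rewrite deckE.
exact/degree_oneZ/chart_degree_one.
Qed.

Lemma chart_has_model :
  (forall F : Gt, mobius_along h (act F)) -> has_model.
Proof.
by move=> hF; exists h; split=> //; [exact: chart_nondecreasing|exact: chart_surj|exact: chart_degree_one].
Qed.

Lemma fixed_point_has_model : (forall F : Gt, exists n : int, act F d = d + n%:~R) ->
  (forall F, Gamma F -> mobius_along h (act F)) -> has_model.
Proof.
move=> orbit hG; apply: chart_has_model => F; have [n Fd] := orbit F.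
have -> : F = (deck G n * (deck G (- n) * F))%g.
  rewrite mulgA -deckD subrr; apply: lift_group_inj => x.
  by rewrite (actM ha) deckE addr0.
have K : Gamma (deck G (- n) * F)%g.
  by rewrite /stabilizer /= (actM ha) deckE Fd mulrNz addrK.
have := mobius_along_comp (chart_mobius_along_deck n) (hG _ K).
by apply.
Qed.
End FixedPoint.

Section TwoFixedPoints.
Variables (d c : R) (F0 : Gt).
Hypotheses (dc : d < c < d + 1) (F0n1 : F0 <> 1%g) (F0d : act F0 d = d).
Hypothesis fix_c : forall F, stabilizer d F -> act F c = c.
Local Notation Gamma := (stabilizer d).
Let hS := stabilizer_subgroup d.

Let J1 := [set x | d < x < c].
Let J2 := [set x | c < x < d + 1].

Lemma stabilizer_sides (F : Gt) : Gamma F ->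
  [\/ F = 1%g,
      (forall x, J1 x -> x < act F x) /\ (forall x, J2 x -> act F x < x) |
      (forall x, J1 x -> act F x < x) /\ (forall x, J2 x -> x < act F x)].
Proof.
move=> Fd; have [->|F1] := pselect (F = 1%g); first by constructor 1.
by have [h|h] := two_fixed_points hM F1 dc Fd (fix_c Fd); [constructor 2|constructor 3].
Qed.

Lemma free_left : acts_freely (@act _ G) Gamma J1.
Proof.
split=> [F x Fd|F Fd]; first by apply: gap_image => //; exact: fix_c.
by case: (stabilizer_sides Fd) => [->|[]|[]]; [constructor 1|constructor 2|constructor 3].
Qed.

Lemma free_right : acts_freely (@act _ G) Gamma J2.
Proof.
split=> [F x Fd|F Fd]; first by apply: gap_image; [exact: fix_c|exact: stabilizer_end].
by case: (stabilizer_sides Fd) => [->|[]|[]]; [constructor 1|constructor 3|constructor 2].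
Qed.

Lemma moves_left_up : exists2 t, Gamma t & forall x, J1 x -> x < act t x.
Proof.
case: (stabilizer_sides F0d) => [//|[up _]|[down _]]; first by exists F0.
exists F0^-1%g; first exact: (subgroupV hS).
by move=> x Jx; rewrite (lt_actV ha); exact: down.
Qed.

Lemma mid_left : J1 ((d + c) / 2). Proof. rewrite /J1 /=; move: dc; lra. Qed.
Lemma mid_right : J2 ((c + (d + 1)) / 2). Proof. rewrite /J2 /=; move: dc; lra. Qed.

Lemma left_semiconjugacy : exists tau th1,
  order_morphism (@act _ G) Gamma J1 tau /\ semiconjugates (@act _ G) Gamma J1 tau th1.
Proof.
have [t Gt_t up] := moves_left_up.
have intJ : is_interval J1 by exact: is_interval_open.
have tx := up _ mid_left.
have [tau htau] := free_order_morphism ha hS free_left intJ Gt_t mid_left tx.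
have [th hth] := free_semiconjugacy ha hS free_left htau intJ mid_left Gt_t tx.
by exists tau, th.
Qed.

(** By [stabilizer_sides] an element that moves the points up on one side of c moves them down on
    the other side, whence the sign. *)
Lemma right_semiconjugacy tau : order_morphism (@act _ G) Gamma J1 tau ->
  exists th2, semiconjugates (@act _ G) Gamma J2 (fun F => - tau F) th2.
Proof.
move=> htau; have intJ : is_interval J2 by exact: is_interval_open.
have htau' : order_morphism (@act _ G) Gamma J2 (fun F => - tau F).
  split=> [F K FG KG|F x FG Jx xF]; first by rewrite htau.1// opprD.
  rewrite -(additive_onV hS htau.1 FG) -(tau_pos ha hS free_left htau (subgroupV hS FG) mid_left).
  rewrite (lt_actV ha); case: (stabilizer_sides FG) => [F1|[_ down]|[down _]].
  - by move: xF; rewrite F1 (act1 ha) ltxx.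
  - by have := down _ Jx; rewrite ltNge ltW.
  - exact: down mid_left.
have [t tG up] := moves_left_up.
have tV := subgroupV hS tG.
have tx : (c + (d + 1)) / 2 < act t^-1%g ((c + (d + 1)) / 2).
  rewrite (lt_actV ha); case: (stabilizer_sides tG) => [t1|[_ down]|[down _]].
  - by have := up _ mid_left; rewrite t1 (act1 ha) ltxx.
  - exact: down mid_right.
  - by have := down _ mid_left; rewrite ltNge ltW//; exact: up mid_left.
exact: (free_semiconjugacy ha hS free_right htau' intJ mid_right tV tx).
Qed.

Variables (tau : Gt -> R) (th1 th2 : R -> R).
Hypotheses (hth1 : semiconjugates (@act _ G) Gamma J1 tau th1).
Hypotheses (hth2 : semiconjugates (@act _ G) Gamma J2 (fun F => - tau F) th2).

(** The two sides of c become the two half-lines.  As th1 and th2 vary by tau and - tau, both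
    halves are multiplied by the same factor exp (- tau), see [glue_act]. *)
Definition glue x := if x < c then - expR (- th1 x) else if x == c then 0 else expR (th2 x).

Lemma glue_left x : d < x < c -> glue x = - expR (- th1 x).
Proof. by rewrite /glue => /andP[_ ->]. Qed.
Lemma glue_c : glue c = 0. Proof. by rewrite /glue ltxx eqxx. Qed.
Lemma glue_right x : c < x -> glue x = expR (th2 x).
Proof. by move=> cx; rewrite /glue ltNge (ltW cx)/= gt_eqF. Qed.

Lemma glue_nondecreasing : nondecreasing_on [set x | d < x < d + 1] glue.
Proof.
have dc' := dc.
have [nd1 _ _] := hth1; have [nd2 _ _] := hth2.
move=> x y; rewrite !inE => /andP[dx xd] /andP[dy yd] xy.
have pos z : 0 < expR (z : R) by exact: expR_gt0.
have [xc|cx|xE] := ltgtP x c.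
- rewrite glue_left ?dx//; have [yc|cy|yE] := ltgtP y c.
  + rewrite glue_left ?dy// lerN2 ler_expR lerN2; apply: nd1 => //; rewrite inE /J1/=; lra.
  + by rewrite glue_right//; have := pos (- th1 x); have := pos (th2 y); lra.
  + by rewrite yE glue_c; have := pos (- th1 x); lra.
- rewrite !glue_right//; last lra.
  by rewrite ler_expR; apply: nd2 => //; rewrite inE /J2/=; lra.
- rewrite xE glue_c; have [yc|cy|->] := ltgtP y c; [lra| |by rewrite glue_c].
  by rewrite glue_right// ltW.
Qed.

Lemma glue_onto : onto [set x | d < x < d + 1] glue.
Proof.
have dc' := dc.
have [_ on1 _] := hth1; have [_ on2 _] := hth2.
move=> r; have [r0|r0|->] := ltgtP r 0.
- have [x Jx xE] := on1 (- ln (- r)); exists x; first by move: Jx; rewrite /J1/=; lra.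
  by rewrite glue_left// xE opprK lnK ?opprK// posrE oppr_gt0.
- have [x Jx xE] := on2 (ln r); exists x; first by move: Jx; rewrite /J2/=; lra.
  by rewrite glue_right ?xE ?lnK//; move: Jx => /andP[].
- by exists c => //; exact: glue_c.
Qed.

Lemma glue_act F x : Gamma F -> d < x < d + 1 ->
  glue (act F x) = expR (- tau F) * glue x + 0.
Proof.
have dc' := dc.
move=> FG /andP[dx xd]; rewrite addr0.
have [_ _ eqv1] := hth1; have [_ _ eqv2] := hth2.
have [xc|cx|->] := ltgtP x c.
- have Jx : J1 x by rewrite /J1/= dx.
  have JFx := free_left.1 F x FG Jx.
  by rewrite !glue_left// eqv1// opprD expRD mulrN mulrC.
- have Jx : J2 x by rewrite /J2/= cx.
  have /andP[cFx _] := free_right.1 F x FG Jx.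
  by rewrite !glue_right// eqv2// expRD mulrC.
- by rewrite fix_c// glue_c mulr0.
Qed.

Lemma glue_mobius_along F : Gamma F -> mobius_along (chart d glue) (act F).
Proof.
move=> FG; apply: (chart_mobius_along FG (expR_gt0 (- tau F)) (be := 0)) => x xin.
exact: glue_act.
Qed.
End TwoFixedPoints.

Section Swap.
Variables (d c : R) (s : Gt).
Hypotheses (dc : d < c < d + 1) (sd : act s d = c) (sc : act s c = d + 1).

(** Up to a translation the square of s fixes d and c.  It commutes with s, which exchanges the
    two arcs, so it moves them in the same sense, which only the identity does. *)
Lemma swap_square : (s * s)%g = deck G 1.
Proof.
have dc' := dc.
pose f := (deck G (-1) * (s * s))%g.
have fE x : act f x = act s (act s x) - 1 by rewrite /f !(actM ha) deckE mulrNz.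
have fd : act f d = d by rewrite fE sd sc addrK.
have fc : act f c = c by rewrite fE sc (actD s d 1) sd addrK.
have comm x : act f (act s x) = act s (act f x).
  by rewrite !fE -mulrN1z (actD s (act s (act s x)) (-1)).
suff f1 : f = 1%g.
  by rewrite -[LHS](mulKg (deck G (-1))) -/f f1 mulg1; apply/mulg1_eq;
     rewrite -deckD; apply: lift_group_inj => x; rewrite deckE addr0.
apply: contrapT => fn1; pose m := (d + c) / 2.
have md : d < m < c by rewrite /m; lra.
have sm : c < act s m < d + 1 by rewrite -{1}sd -sc !(act_ltE ha).
have [[h1 h2]|[h1 h2]] := two_fixed_points hM fn1 dc fd fc.
- by have := h2 _ sm; rewrite comm (act_ltE ha) => lt; have := h1 _ md; lra.
- by have := h2 _ sm; rewrite comm (act_ltE ha) => lt; have := h1 _ md; lra.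
Qed.
End Swap.

(** As s F also exchanges d and c, both s and s F have square the translation by 1. *)
Lemma swap_inverts (d c : R) (s F : Gt) : d < c < d + 1 -> act s d = c -> act s c = d + 1 ->
  act F d = d -> act F c = c -> (s^-1 * F * s)%g = F^-1%g.
Proof.
move=> dc sd sc Fd Fc.
have sF2 : (s * F * (s * F))%g = deck G 1.
  by apply: (swap_square dc); rewrite (actM ha) ?Fd ?Fc.
have := swap_square dc sd sc; rewrite -sF2 -!mulgA => /mulgI e.
have sF : (F * s)%g = (s * F^-1)%g by apply: (@mulIg _ F); rewrite mulgVK -mulgA -e.
by rewrite sF mulKg.
Qed.

Lemma swap_has_model (d c : R) (s F0 : Gt) : d < c < d + 1 -> act s d = c -> act s c = d + 1 ->
  F0 <> 1%g -> act F0 d = d -> (forall F, stabilizer d F -> act F c = c) ->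
  (forall F : Gt, exists n : int, act F d = d + n%:~R \/ act F d = c + n%:~R) ->
  has_model.
Proof.
move=> dc sd sc F01 F0d fix_c orbit.
have [tau [th1 [htau hth1]]] := left_semiconjugacy dc F01 F0d fix_c.
have hS := stabilizer_subgroup d.
have [nd1 on1 eqv1] := hth1.
have sJ x : d < x < c -> c < act s x < d + 1 by move=> xin; rewrite -sc -[X in X < _]sd !(act_ltE ha).
have sVJ x : c < x < d + 1 -> d < act s^-1%g x < c.
  by rewrite (lt_actV ha) (actV_lt ha) sd sc.
(* on the right side, th2 is th1 transported by s, which inverts the stabilizer *)
pose th2 x := th1 (act s^-1%g x).
have hth2 : semiconjugates (@act _ G) (stabilizer d) [set x | c < x < d + 1] (fun F => - tau F) th2.
  split.
  - move=> x y; rewrite !inE => Jx Jy xy; apply: nd1; rewrite ?inE /=; [exact: sVJ..|].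
    by rewrite (act_leE ha).
  - move=> r; have [x Jx xE] := on1 r; exists (act s x); first exact: sJ.
    by rewrite /th2 (actVK ha).
  - move=> F x FG Jx; rewrite /th2.
    have e : (s^-1 * F)%g = (F^-1 * s^-1)%g.
      by rewrite -(swap_inverts dc sd sc FG (fix_c _ FG)) mulgK.
    rewrite -(actM ha) e (actM ha) eqv1 ?(additive_onV hS htau.1)//; first exact: (subgroupV hS).
    exact: sVJ.
have Jnd := glue_nondecreasing dc hth1 hth2.
have Jon := glue_onto dc hth1 hth2.
apply: (chart_has_model Jnd Jon).
set Th := glue _ _ _; set h := chart d Th.
have hdom y : d <= y < d + 1 -> h y = period_chart d Th y.
  by move=> yin; rewrite -[in LHS](addr0 y) /h (chartE Th 0 yin) addr0.
have h1 : degree_one h by exact: chart_degree_one.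
have pi0 := @pi_gt0 R.
have hc : h c = 0.
  rewrite hdom; last by lra.
  rewrite /period_chart gt_eqF; last by lra.
  by rewrite /Th glue_c atan0 mul0r.
have hd : h d = - 2^-1 by rewrite hdom ?/period_chart ?eqxx//; lra.
(* s acts on slopes by t |-> - 1 / t, which is the half turn of the projective line *)
have left y : d < y < c -> h (act s y) = h y + 2^-1.
  move=> yin; have /andP[s1 s2] := sJ _ yin.
  rewrite !hdom; [|lra|lra].
  rewrite /period_chart !gt_eqF; [|lra|lra].
  rewrite /Th glue_right// (glue_left _ _ yin) /th2 (actVK ha) atanN expRN atanV ?expR_gt0//.
  by rewrite mulNr mulrBl [pi / 2 / pi]mulrAC divff ?gt_eqF//; lra.
have hs y : h (act s y) = h y + 2^-1.
  have [n [z [-> zin]]] := fundamental_domain d y.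
  suff e : h (act s z) = h z + 2^-1.
    by rewrite actD !(degree_oneZ h1) e -!addrA [2^-1 + _]addrC.
  have [->|zd] := eqVneq z d; first by rewrite sd hc hd; lra.
  have dz : d < z by rewrite lt_neqAle eq_sym zd; lra.
  have [zc|cz|->] := ltgtP z c; first by apply: left; rewrite dz.
    have wz : d < act s^-1%g z < c by apply: sVJ; lra.
    rewrite -(actKV ha s z) (left _ wz) -(actM ha) (swap_square dc sd sc) deckE.
    by rewrite (h1 (act s^-1%g z)); lra.
  by rewrite sc h1 hd hc; lra.
have hG F : stabilizer d F -> mobius_along h (act F).
  by move=> FG; exact: (glue_mobius_along dc fix_c hth1 hth2).
have hdeck := chart_mobius_along_deck d Th.
have hs' : mobius_along h (act s) by exact: mobius_along_translation hs.
move=> F; have [n [Fd|Fd]] := orbit F.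
  have K : stabilizer d (deck G (- n) * F)%g.
    by rewrite /stabilizer /= (actM ha) deckE Fd mulrNz addrK.
  have -> : act F = act (deck G n) \o act (deck G (- n) * F)%g.
    by apply/funext => x /=; rewrite (actM ha) !deckE mulrNz subrK.
  by apply: mobius_along_comp; [exact: hdeck|exact: hG].
have K : stabilizer d (s^-1 * (deck G (- n) * F))%g.
  by rewrite /stabilizer /= !(actM ha) deckE Fd mulrNz addrK; exact: (actV_eq ha).
have -> : act F = act (deck G n) \o (act s \o act (s^-1 * (deck G (- n) * F))%g).
  by apply/funext => x /=; rewrite !(actM ha) (actKV ha) !deckE mulrNz subrK.
by apply: mobius_along_comp; [exact: hdeck|apply: mobius_along_comp => //; exact: hG].
Qed.

(** As F0 has at most two fixed points modulo 1, the orbit of d is either d + Z, in which case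
    Gt is generated by the stabilizer of d and by the translations, or the union of d + Z and
    c + Z, which are exchanged by some element s. *)
Lemma orbit_has_model (d : R) (F0 : Gt) : F0 <> 1%g ->
  (forall F : Gt, act F0 (act F d) = act F d) -> has_model.
Proof.
move=> F01 orb; have F0d : act F0 d = d by have := orb 1%g; rewrite (act1 ha).
have hS := stabilizer_subgroup d.
have [glob|] := pselect (forall F : Gt, exists n : int, act F d = d + n%:~R).
  have [[c [dc fix_c]]|nofix] :=
      pselect (exists c, d < c < d + 1 /\ forall F, stabilizer d F -> act F c = c).
    have [tau [th1 [htau hth1]]] := left_semiconjugacy dc F01 F0d fix_c.
    have [th2 hth2] := right_semiconjugacy dc F01 F0d fix_c htau.
    apply: (fixed_point_has_model (glue_nondecreasing dc hth1 hth2) (glue_onto dc hth1 hth2) glob).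
    by move=> F FG; exact: (glue_mobius_along dc fix_c hth1 hth2).
  have {}nofix c : d < c < d + 1 -> exists2 F, stabilizer d F & act F c <> c.
    move=> dc; apply: contrapT => none; apply: nofix; exists c; split=> // F FG.
    by apply: contrapT => Fc; apply: none; exists F.
  have mid : d < d + 2^-1 < d + 1 by lra.
  have [g gG gm] := nofix _ mid.
  have [th [nd on aff]] := solodov ha hS (stabilizer_affine_like d) gG mid gm nofix.
  apply: (fixed_point_has_model nd on glob) => F FG.
  have [al [be [al0 FE]]] := aff F FG.
  exact: chart_mobius_along FG al0 FE.
move=> /existsNP[s0 s0d].
have [n [c [s0E cin]]] := fundamental_domain d (act s0 d).
pose s := (deck G (- n) * s0)%g.
have sE : act s d = c by rewrite (actM ha) deckE s0E mulrNz addrK.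
have dc : d < c < d + 1.
  have : d != c by apply/eqP => e; apply: s0d; exists n; rewrite s0E -e.
  by move=> dnc; rewrite lt_neqAle dnc.
have F0c : act F0 c = c by rewrite -sE.
have only_two y : act F0 y = y -> d <= y < d + 1 -> y = d \/ y = c.
  move=> Fy yin; have [->|yd] := eqVneq y d; [by left|right].
  apply: contrapT => yc; apply: F01; apply: (third_fixed_point hM dc _ F0d F0c Fy).
    by have : d < y; [rewrite lt_neqAle eq_sym yd; lra|lra].
  by move=> e; apply: yc.
have orbit (F : Gt) : exists n : int, act F d = d + n%:~R \/ act F d = c + n%:~R.
  have [k [y [yE yin]]] := fundamental_domain d (act F d).
  have Fy : act F0 y = y.
    by have := orb (deck G (- k) * F)%g; rewrite (actM ha) deckE yE mulrNz addrK.
  by exists k; rewrite yE; case: (only_two y Fy yin) => ->; [left|right].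
have fix_c F : stabilizer d F -> act F c = c.
  move=> FG; have FcF : d < act F c < d + 1 by apply: gap_image => //; exact: stabilizer_end.
  have FFc : act F0 (act F c) = act F c by have := orb (F * s)%g; rewrite (actM ha) sE.
  have /(only_two _ FFc)[] : d <= act F c < d + 1 by lra.
    by lra.
  by [].
have sc : act s c = d + 1.
  have lo : c < act s c by rewrite -{1}sE (act_ltE ha); lra.
  have hi : act s c < c + 1 by rewrite -{2}sE -(actD s d 1) (act_ltE ha); lra.
  have Fsc : act F0 (act s c) = act s c by have := orb (s * s)%g; rewrite (actM ha) sE.
  have [lt|gt|//] := ltgtP (act s c) (d + 1).
    have /(only_two _ Fsc)[] : d <= act s c < d + 1 by lra.
      by lra.
    by lra.
  have : act F0 (act s c - 1) = act s c - 1.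
    by have := actD F0 (act s c) (-1); rewrite mulrNz Fsc.
  have dom : d <= act s c - 1 < d + 1 by lra.
  by move=> /only_two/(_ dom)[]; lra.
exact: (swap_has_model dc sE sc F01 F0d fix_c orbit).
Qed.

Theorem model_exists : elementary [set g | g \in G] -> has_model.
Proof.
move=> [mu muG].
have [free|] := pselect (forall (F : Gt) x, act F x = x -> F = 1%g).
  exact: free_has_model.
move=> /existsNP[F0 /existsNP[x0 /not_implyP[Fx0 F01]]].
have [d orb] := fixed_orbit hM muG F01 Fx0.
exact: orbit_has_model F01 orb.
Qed.
End Construction.

Theorem theorem1 (R : realType) (G : groupClosed (homeo_plus R))
    (hE : elementary [set g | g \in G]) (hM : mobius_like [set g | g \in G]) :
  exists psi : {multiplicative subgroup G -> PSL2 R},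
    [/\ injective psi,
        elementary (range (fun g => val (psi g)))
      & continuously_semiconjugate (fun g : subgroup G => val g)
          (fun g => val (psi g))].
Proof.
have [h [h_nd h_surj h1 h_mobius]] := model_exists hM hE.
apply: (semiconjugacy_of_map h_nd h_surj h1 h_mobius _ hE) => F.
exact: invariant_map_trivial.
Qed.
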